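(* Let $E/\mathbb{Q}$ be an elliptic curve given by $y^2=x^3+a_4x+a_6$ with $a_4,a_6\in\mathbb{Z}$, and for positive integers $t$ put $D(t):=4(t^3+a_4t-a_6)$. If $E(\mathbb{Q})$ has positive rank and $t$ is any positive integer for which $$4(t+1)^2\exp(4\delta(E))<D(t)<(t+1)^2t^2,$$ then for every non-torsion point $P\in E(\mathbb{Q})$ we have $$\widehat{h}(P)\ >\ \frac{\pi^2|E_{\mathrm{tor}}(\mathbb{Q})|^2}{\left(\sqrt{D(t)}\,(\log D(t)+2)+\pi|E_{\mathrm{tor}}(\mathbb{Q})|\right)^2}\cdot T_E(-D(t),t).$$
   Context: $E_{\mathrm{tor}}(\mathbb{Q})$ denotes the torsion subgroup of $E(\mathbb{Q})$. Heights: each affine point $P\in E(\mathbb{Q})$ is written $P=\left(\frac{A}{C^2},\frac{B}{C^3}\right)$ with $A,B,C\in\mathbb{Z}$ and $\gcd(A,C)=\gcd(B,C)=1$. The naive height is $H(P):=\max(|A|,|C^2|)$, the logarithmic (Weil) height is $h_W(P):=\log H(P)$ (with $h_W=0$ at the identity), and the canonical height is $\widehat{h}(P):=\tfrac12\lim_{n\to\infty}\frac{h_W(nP)}{n^2}$. The non-negative real number $\delta(E)$ is $$\delta(E):=\max_{P\in E(\mathbb{Q})}\left(\tfrac12 h_W(P)-\widehat{h}(P)\right)$$ (the value $0$ is attained by the identity of $E(\mathbb{Q})$), and $$T_E(-D,t):=\log\left(\frac{D}{4(t+1)^2}\right)-4\delta(E).$$ *)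

(* Defs.v *)
From HB Require Import structures.
From mathcomp Require Import all_boot all_order all_algebra.
From mathcomp Require Import finmap ring.
From mathcomp Require Import all_classical all_reals all_analysis.

Set Implicit Arguments.
Unset Strict Implicit.
Unset Printing Implicit Defensive.

Import Order.TTheory GRing.Theory Num.Theory.
Import numFieldNormedType.Exports.

Local Open Scope classical_set_scope.
Local Open Scope ring_scope.

(* [None] is the point at infinity, which is the identity of the group law. *)
Definition ecpoint : Type := option (rat * rat).

Definition nonsingular (a4 a6 : int) : Prop :=
  - 16 * (4 * a4 ^+ 3 + 27 * a6 ^+ 2) != 0.

Definition EQ (a4 a6 : int) : set ecpoint :=
  [set P | match P with
           | None => True
           | Some (x, y) => y ^+ 2 = x ^+ 3 + a4%:~R * x + a6%:~R
           end].

Definition ecopp (P : ecpoint) : ecpoint :=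
  if P is Some (x, y) then Some (x, - y) else None.

(* Chord-and-tangent law of y^2 = x^3 + a4 x + a6. It is total, but it is
   meaningful only for points of [EQ a4 a6]. *)
Definition ecadd (a4 : int) (P Q : ecpoint) : ecpoint :=
  match P, Q with
  | None, _ => Q
  | _, None => P
  | Some (x1, y1), Some (x2, y2) =>
      if (x1 == x2) && (y1 == - y2) then None else
      let s := if x1 == x2 then (3 * x1 ^+ 2 + a4%:~R) / (2 * y1)
               else (y2 - y1) / (x2 - x1) in
      let x3 := s ^+ 2 - x1 - x2 in
      Some (x3, s * (x1 - x3) - y1)
  end.

Definition ecmuln (a4 : int) (n : nat) (P : ecpoint) : ecpoint :=
  iter n (ecadd a4 P) None.

Definition ecmulz (a4 : int) (m : int) (P : ecpoint) : ecpoint :=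
  match m with
  | Posz n => ecmuln a4 n P
  | Negz n => ecopp (ecmuln a4 n.+1 P)
  end.

Definition Etor (a4 a6 : int) : set ecpoint :=
  [set P | EQ a4 a6 P /\ exists2 n : nat, (0 < n)%N & ecmuln a4 n P = None].

(* [fset_set] sends infinite sets to the empty one, but torsion subgroups
   over the rationals are finite. *)
Definition card_tor (a4 a6 : int) : nat := #|` fset_set (Etor a4 a6)|.

Definition Zindependent (a4 a6 : int) (n : nat) (P : 'I_n -> ecpoint) : Prop :=
  (forall i, EQ a4 a6 (P i)) /\
  forall c : 'I_n -> int,
    \big[ecadd a4/None]_(i < n) ecmulz a4 (c i) (P i) = None ->
    forall i, c i = 0.

(* The supremum is taken in the extended reals, so that no finiteness of the
   rank is built in. *)
Definition ecrank (R : realType) (a4 a6 : int) : \bar R :=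
  ereal_sup [set (n%:R)%:E | n in
    [set n : nat | exists P : 'I_n -> ecpoint, Zindependent a4 a6 P]].

Lemma ecpoint_lowest_terms (a4 a6 : int) (x y : rat) :
  EQ a4 a6 (Some (x, y)) ->
  exists A B C : int, [/\ C != 0, coprimez A C, coprimez B C,
    x = A%:~R / C%:~R ^+ 2 & y = B%:~R / C%:~R ^+ 3].
Proof.
rewrite /EQ /= => hxy.
set a := numq x; set d := denq x; set b := numq y; set e := denq y.
have d0 : 0 < d by apply: denq_gt0.
have e0 : 0 < e by apply: denq_gt0.
have dq0 : d%:~R != 0 :> rat by rewrite intr_eq0 gt_eqF.
have eq0 : e%:~R != 0 :> rat by rewrite intr_eq0 gt_eqF.
have cad : coprimez a d by apply: coprime_num_den.
have cbe : coprimez b e by apply: coprime_num_den.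
have xE : x = a%:~R / d%:~R by rewrite divq_num_den.
have yE : y = b%:~R / e%:~R by rewrite divq_num_den.
pose u := a4 * a * d + a6 * d ^+ 2.
have key : b ^+ 2 * d ^+ 3 = e ^+ 2 * (a ^+ 3 + u * d).
  apply: (@intr_inj rat); rewrite /u !(rmorphD, rmorphM, rmorphXn) /=.
  have -> : a%:~R = x * d%:~R by rewrite xE mulfVK.
  have -> : b%:~R = y * e%:~R by rewrite yE mulfVK.
  by rewrite exprMn hxy; ring.
have de : (d ^+ 3 %| e ^+ 2)%Z.
  have cop : coprimez (d ^+ 3) (a ^+ 3 + u * d).
    by rewrite coprimezXl // coprimez_sym /coprimez gcdzC addrC gcdzMDl gcdzC;
      apply: coprimezXl.
  by rewrite -(Gauss_dvdzl _ cop) -key dvdz_mull.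
have ed : (e ^+ 2 %| d ^+ 3)%Z.
  have cop : coprimez (e ^+ 2) (b ^+ 2).
    by rewrite coprimezXl // coprimezXr // coprimez_sym.
  by rewrite -(Gauss_dvdzr _ cop) key dvdz_mulr.
have e2d3 : e ^+ 2 = d ^+ 3.
  apply/eqP; rewrite -[e ^+ 2]gtr0_norm ?exprn_gt0 // -[d ^+ 3]gtr0_norm
    ?exprn_gt0 // -!abszE eqz_nat eqn_dvd; exact/andP.
have /dvdzP[C eE] : (d %| e)%Z.
  by rewrite -(@dvdz_pexp2r _ _ 2) // e2d3 exprS dvdz_mull.
have dE : d = C ^+ 2.
  apply: (mulIf (x := d ^+ 2)); first by rewrite expf_neq0 ?gt_eqF.
  by rewrite -exprMn -eE e2d3 -exprS.
have eE3 : e = C ^+ 3 by rewrite eE dE -exprS.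
have C0 : C != 0 by apply: contraTneq d0 => C0; rewrite dE C0 expr0n.
exists a, b, C; split => //; last 2 first.
- by rewrite xE dE rmorphXn.
- by rewrite yE eE3 rmorphXn.
- by move: cad; rewrite dE coprimez_pexpr.
- by move: cbe; rewrite eE3 coprimez_pexpr.
Qed.

(* For x = A / C^2 as in [ecpoint_lowest_terms], the numerator and the
   denominator of x are A and C^2, so this is max(|A|, C^2): see
   [naive_heightE]. *)
Definition naive_height (P : ecpoint) : int :=
  if P is Some (x, _) then Num.max `|numq x| (denq x) else 1.

Lemma naive_heightE (A C : int) (y : rat) : C != 0 -> coprimez A C ->
  naive_height (Some (A%:~R / C%:~R ^+ 2, y)) = Num.max `|A| (C ^+ 2).
Proof.
move=> C0 cAC; have cop : coprime `|A| `|C ^+ 2| by rewrite abszX coprimeXr.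
have C2 : 0 < C ^+ 2 by rewrite exprn_even_gt0.
rewrite /naive_height -rmorphXn coprimeq_num // coprimeq_den //.
by rewrite (gt_eqF C2) (gtr0_sg C2) mul1r (gtr0_norm C2).
Qed.

Definition weil_height (R : realType) (P : ecpoint) : R :=
  ln (naive_height P)%:~R.

Definition canonical_height (R : realType) (a4 : int) (P : ecpoint) : R :=
  2^-1 * lim ((fun n : nat => weil_height R (ecmuln a4 n P) / n%:R ^+ 2) @ \oo).

(* A supremum rather than a maximum: it is finite, but it need not be
   attained. *)
Definition delta (R : realType) (a4 a6 : int) : R :=
  sup [set 2^-1 * weil_height R P - canonical_height R a4 P | P in EQ a4 a6].

Definition Dt (a4 a6 : int) (t : nat) : int :=
  4 * (t%:Z ^+ 3 + a4 * t%:Z - a6).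

(* This is T_E(-D, t): the argument is D, not -D. *)
Definition TE (R : realType) (a4 a6 : int) (D : int) (t : nat) : R :=
  ln (D%:~R / (4 * (t%:R + 1) ^+ 2)) - 4 * delta R a4 a6.

(* Main.v *)
(* No class groups are needed. The points tau + m P, with tau torsion and
   |m| <= M, all have canonical height m^2 h(P), hence at most T_E / 4 for
   M = floor (sqrt (T_E / h(P)) / 2). For such points the definition of delta
   bounds the naive height by sqrt D / (2 (t + 1)), which is less than t / 2.
   So, writing x = A / C^2, the integer A + t C^2 lies in [1, sqrt D / 2] and
   determines A and C^2, and with them the point up to sign. This leaves room
   for at most sqrt D <= sqrt D (log D + 2) / pi points, and there are
   |E_tor| (2 M + 1) > |E_tor| (sqrt (T_E / h(P)) - 1) of them.

   The group law is obtained from ideals of the ring Q[X, Y] / (Y^2 - f):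
   if R = P + Q then a I_P I_Q = b I_R for some nonzero a, b, and the ideal of
   an affine point is never principal. The canonical height rests on the
   approximate parallelogram law, proved from the formulas for x(P + Q) +
   x(P - Q), x(P + Q) x(P - Q) and x(2 P). *)
From HB Require Import structures.
Require Import Defs.
From mathcomp Require Import all_boot all_order all_algebra.
From mathcomp Require Import finmap ring lra zify.
From mathcomp Require Import all_classical all_reals all_analysis.
Import Order.TTheory GRing.Theory Num.Theory.
Import numFieldNormedType.Exports.
Set Implicit Arguments.
Unset Strict Implicit.
Unset Printing Implicit Defensive.
Local Open Scope classical_set_scope.
Local Open Scope ring_scope.

(** * The coordinate ring *)

(* The pair (p, q) stands for p + q Y in Q[X, Y] / (Y^2 - f). *)
Definition coord (f : {poly rat}) : Type := ({poly rat} * {poly rat})%type.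

Section CoordinateRing.
Variable f : {poly rat}.

HB.instance Definition _ :=
  GRing.Zmodule.copy (coord f) ({poly rat} * {poly rat})%type.

Definition coord_mul (g h : coord f) : coord f :=
  (g.1 * h.1 + g.2 * h.2 * f, g.1 * h.2 + g.2 * h.1).

Fact coord_mulA : associative coord_mul.
Proof. by move=> [a b] [c d] [k l]; congr (_, _) => /=; ring. Qed.

Fact coord_mulC : commutative coord_mul.
Proof. by move=> [a b] [c d]; congr (_, _) => /=; ring. Qed.

Fact coord_mul1 : left_id ((1, 0) : coord f) coord_mul.
Proof. by move=> [a b]; congr (_, _) => /=; ring. Qed.

Fact coord_mulD : left_distributive coord_mul +%R.
Proof. by move=> [a b] [c d] [k l]; congr (_, _) => /=; ring. Qed.

Fact coord_oner_neq0 : ((1, 0) : coord f) != 0.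
Proof. by rewrite xpair_eqE oner_eq0. Qed.

HB.instance Definition _ := GRing.Zmodule_isComNzRing.Build (coord f)
  coord_mulA coord_mulC coord_mul1 coord_mulD coord_oner_neq0.

Definition cst (c : rat) : coord f := (c%:P, 0).
Definition Xc : coord f := ('X, 0).
Definition Yc : coord f := (0, 1).

Fact cst_is_zmod_morphism : zmod_morphism cst.
Proof. by move=> c d; rewrite /cst polyCB; congr (_, _); rewrite subr0. Qed.

Fact cst_is_monoid_morphism : monoid_morphism cst.
Proof. by split=> // c d; rewrite /cst polyCM; congr (_, _) => /=; ring. Qed.

HB.instance Definition _ :=
  GRing.isZmodMorphism.Build rat (coord f) cst cst_is_zmod_morphism.
HB.instance Definition _ :=
  GRing.isMonoidMorphism.Build rat (coord f) cst cst_is_monoid_morphism.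

Lemma coordME (g h : coord f) :
  g * h = (g.1 * h.1 + g.2 * h.2 * f, g.1 * h.2 + g.2 * h.1).
Proof. by []. Qed.

Definition cnorm (g : coord f) : {poly rat} := g.1 ^+ 2 - g.2 ^+ 2 * f.

Lemma cnormM (g h : coord f) : cnorm (g * h) = cnorm g * cnorm h.
Proof. by rewrite /cnorm coordME /=; ring. Qed.

Hypothesis size_f : size f = 4%N.

(* The two summands of the norm have degrees of opposite parity, so they
   cannot cancel. *)
Lemma size_cnorm (g : coord f) :
  size (cnorm g) = maxn (2 * size g.1).-1 (2 * size g.2 + (size g.2 != 0) * 2)%N.
Proof.
have f0 : f != 0 by rewrite -size_poly_gt0 size_f.
have s1 : size (g.1 ^+ 2) = (2 * size g.1).-1%N.
  have [->|g0] := eqVneq g.1 0; first by rewrite expr0n size_poly0.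
  by rewrite expr2 size_mul // addnn mul2n.
have s2 : size (- (g.2 ^+ 2 * f)) = (2 * size g.2 + (size g.2 != 0%N) * 2)%N.
  rewrite size_polyN; have [->|g0] := eqVneq g.2 0.
    by rewrite expr0n mul0r size_poly0.
  rewrite size_mul ?expf_neq0 // size_f expr2 size_mul // addnn.
  by move: g0; rewrite -size_poly_gt0; move: (size g.2) => n; lia.
rewrite -s1 -s2; case: (ltngtP (size (g.1 ^+ 2)) (size (- (g.2 ^+ 2 * f)))).
- by move=> lt; rewrite /cnorm addrC size_polyDl.
- by move=> lt; rewrite /cnorm size_polyDl.
rewrite s1 s2 => eq12; rewrite -{1}s1.
have g1 : size g.1 = 0%N by lia.
have g2 : size g.2 = 0%N by lia.
rewrite s1 g1; move/eqP: g1; move/eqP: g2; rewrite !size_poly_eq0 /cnorm.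
by move=> /eqP-> /eqP->; rewrite expr0n mul0r subr0 size_poly0.
Qed.

Lemma size_cnorm_neq2 (g : coord f) : size (cnorm g) != 2%N.
Proof. by rewrite size_cnorm; lia. Qed.

(** With [cnormM] this makes the coordinate ring a domain, so that factors can be cancelled in
    identities between ideals. *)
Lemma cnorm_eq0 (g : coord f) : cnorm g = 0 -> g = 0.
Proof.
move/eqP; rewrite -size_poly_eq0 size_cnorm => h.
have : size g.1 == 0%N by lia.
have : size g.2 == 0%N by lia.
by rewrite !size_poly_eq0 => /eqP h2 /eqP h1; case: g h1 h2 {h} => /= ? ? -> ->.
Qed.

Lemma cnorm_const (g : coord f) :
  size (cnorm g) = 1%N -> exists2 c : rat, c != 0 & g = cst c.
Proof.
rewrite size_cnorm => h.
have /eqP : size g.2 = 0%N by lia.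
have /size_poly1P[c c0 g1] : size g.1 == 1%N by lia.
rewrite size_poly_eq0 => /eqP g2; exists c => //.
by case: g g1 g2 {h} => /= ? ? -> ->.
Qed.

Lemma coord_mul_eq0 (g h : coord f) : g * h = 0 -> g = 0 \/ h = 0.
Proof.
move=> /(congr1 cnorm); rewrite cnormM {3}/cnorm expr0n mul0r subr0.
by move/eqP; rewrite mulf_eq0 => /orP[] /eqP /cnorm_eq0; [left|right].
Qed.

Lemma coord_mulI (g h k : coord f) : g != 0 -> g * h = g * k -> h = k.
Proof.
move=> g0 /eqP; rewrite -subr_eq0 -mulrBr => /eqP /coord_mul_eq0[/eqP|/eqP].
  by rewrite (negPf g0).
by rewrite subr_eq0 => /eqP.
Qed.

Lemma coord_mulf_neq0 (g h : coord f) : g != 0 -> h != 0 -> g * h != 0.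
Proof. by move=> g0 h0; apply/eqP => /coord_mul_eq0[] /eqP; apply/negP. Qed.

Definition coord_eval (x y : rat) (g : coord f) : rat := g.1.[x] + g.2.[x] * y.

(* The ideal of a point, given by its generators; the point at infinity
   imposes no condition on the affine functions. *)
Definition ptideal (P : ecpoint) (g : coord f) : Prop :=
  if P is Some (x, y)
  then exists u w, g = u * (Xc - cst x) + w * (Yc - cst y) else True.

(** Lets the ideals of points on a common line share the equation of that line as a generator. *)
Lemma ptideal_line x y s g : ptideal (Some (x, y)) g <->
  exists u w, g = u * (Xc - cst x) + w * (Yc - cst (y - s * x) - cst s * Xc).
Proof.
split=> [] [u [w ->]].
  by exists (u + w * cst s), w; ring.
by exists (u - w * cst s), w; ring.
Qed.

Lemma ptidealD P g h : ptideal P g -> ptideal P h -> ptideal P (g + h).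
Proof.
case: P => [[x y]|] //= [u [w ->]] [u' [w' ->]].
by exists (u + u'), (w + w'); ring.
Qed.

Lemma ptidealMl P g h : ptideal P h -> ptideal P (g * h).
Proof.
by case: P => [[x y]|] //= [u [w ->]]; exists (g * u), (g * w); ring.
Qed.

Lemma ptideal_eval x y g : ptideal (Some (x, y)) g -> y ^+ 2 = f.[x] ->
  coord_eval x y g = 0.
Proof.
case=> u [w ->] hy; rewrite /coord_eval /=.
rewrite !hornerE /= -hy. ring.
Qed.

(* Only the point at infinity has a principal ideal: a generator of the ideal
   of an affine point would have a norm of degree 1. *)
Lemma ptideal_principal x y s : y ^+ 2 = f.[x] ->
  ~ (ptideal (Some (x, y)) s /\ forall g, ptideal (Some (x, y)) g -> exists u, g = u * s).
Proof.
move=> hy [sI gen].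
have XI : ptideal (Some (x, y)) (Xc - cst x) by exists 1, 0; ring.
have YI : ptideal (Some (x, y)) (Yc - cst y) by exists 0, 1; ring.
have [u hu] := gen _ XI; have [v hv] := gen _ YI.
have nX : cnorm (Xc - cst x) = ('X - x%:P) ^+ 2 by rewrite /cnorm /=; ring.
have sX : size (cnorm u * cnorm s) = 3%N.
  by rewrite -cnormM -hu nX size_exp_XsubC.
have n0 : cnorm u * cnorm s != 0 by rewrite -size_poly_gt0 sX.
have /andP[nu0 ns0] : (cnorm u != 0) && (cnorm s != 0).
  by rewrite -negb_or -mulf_eq0.
(* The norms of the cofactor [u] and the generator [s] have degrees adding up to 2, and neither
   degree is 1, so one of the two norms is constant. A constant [u] would make Y - y a multiple of X
   - x; a constant [s] does not vanish at the point. *)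
have [su|ss] : size (cnorm u) = 1%N \/ size (cnorm s) = 1%N.
  move: nu0 ns0 (size_cnorm_neq2 u) (size_cnorm_neq2 s) (size_mul nu0 ns0).
  rewrite sX -!size_poly_gt0; move: (size (cnorm u)) (size (cnorm s)) => m n.
  lia.
  have [c c0 uc] := cnorm_const su.
  have /(congr1 snd) : v * (Xc - cst x) = cst c * (Yc - cst y).
    by rewrite hu hv uc; ring.
  rewrite !coordME /= => /(congr1 (horner^~ x)); rewrite !hornerE /=.
  by move=> h; move/eqP: c0; apply; lra.
have [c c0 sc] := cnorm_const ss.
have := ptideal_eval sI hy; rewrite sc /coord_eval /= !hornerE /= => h.
by move/eqP: c0; apply; lra.
Qed.

End CoordinateRing.

(** * The group law *)

Section GroupLaw.
Variables a4 a6 : int.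

Definition cubic : {poly rat} := 'X^3 + a4%:~R *: 'X + (a6%:~R)%:P.

Lemma size_cubic : size cubic = 4%N.
Proof.
rewrite /cubic -addrA size_polyDl size_polyXn //.
rewrite (leq_ltn_trans (size_polyD _ _)) // gtn_max !ltnS.
rewrite (leq_trans (size_scale_leq _ _)) ?size_polyX //.
by rewrite (leq_trans (size_polyC_leq1 _)).
Qed.

Lemma cubicE x : cubic.[x] = x ^+ 3 + a4%:~R * x + a6%:~R.
Proof. by rewrite /cubic !hornerE. Qed.

Notation X := (Xc cubic).
Notation Y := (Yc cubic).
Notation cst := (cst cubic).

Lemma Yc_sqr : Y ^+ 2 = X ^+ 3 + cst a4%:~R * X + cst a6%:~R.
Proof.
rewrite !exprS !expr0 !coordME /cubic /=; congr (_, _) => /=; last by ring.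
by rewrite -mul_polyC; ring.
Qed.

(* The identity a I_P I_Q = b I_R of ideals; the second clause says that b I_R
   lies in every additive set containing the products, which avoids
   introducing products of ideals. *)
Definition sum_rel (P Q R : ecpoint) (a b : coord cubic) : Prop :=
  (forall g h, ptideal P g -> ptideal Q h ->
     exists2 k, ptideal R k & a * g * h = b * k) /\
  (forall Phi : coord cubic -> Prop,
     (forall g h, Phi g -> Phi h -> Phi (g + h)) ->
     (forall g h, ptideal P g -> ptideal Q h -> Phi (a * g * h)) ->
     forall k, ptideal R k -> Phi (b * k)).

Lemma sum_rel_sym P Q R a b : sum_rel P Q R a b -> sum_rel Q P R a b.
Proof.
move=> [h1 h2]; split=> [g h Qg Ph|Phi PhiD PhiM].
  by have [k Rk e] := h1 _ _ Ph Qg; exists k; rewrite // -e; ring.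
apply: h2 => // g h Pg Qh; have -> : a * g * h = a * h * g by ring.
exact: PhiM.
Qed.

Lemma sum_rel0 Q : sum_rel None Q Q 1 1.
Proof.
split=> [g h _ Qh|Phi PhiD PhiM k Qk].
  by exists (g * h); [apply: ptidealMl|ring].
by have := PhiM 1 k I Qk; rewrite mulr1.
Qed.

(** One inclusion holds because (Y - y)(Y + y) = f - f(x) is divisible by X - x. Conversely, 2 y (X
    - x) is a combination of products of generators; if y = 0, the derivative f'(x), nonzero by
    nonsingularity, replaces 2 y. *)
Lemma sum_rel_opp x y : nonsingular a4 a6 -> EQ a4 a6 (Some (x, y)) ->
  sum_rel (Some (x, y)) (Some (x, - y)) None 1 (X - cst x).
Proof.
rewrite /EQ /nonsingular /= => ns hy.
have cy : cst y ^+ 2 = cst x ^+ 3 + cst a4%:~R * cst x + cst a6%:~R.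
  by rewrite -!rmorphXn -rmorphM -!rmorphD hy.
split=> [_ _ [u [w ->]] [u' [w' ->]]|Phi PhiD PhiM k _].
  pose q := X ^+ 2 + X * cst x + cst x ^+ 2 + cst a4%:~R.
  exists (u * u' * (X - cst x) + u * w' * (Y - cst (- y))
     + w * u' * (Y - cst y) + w * w' * q) => //.
  have e : (Y - cst y) * (Y - cst (- y)) = (X - cst x) * q.
    rewrite rmorphN opprK -subr_sqr Yc_sqr cy /q; ring.
  transitivity ((X - cst x) * (u * u' * (X - cst x) + u * w' * (Y - cst (- y))
     + w * u' * (Y - cst y)) + w * w' * ((Y - cst y) * (Y - cst (- y)))).
    ring.
  by rewrite e; ring.
have [y0|y0] := eqVneq y 0; last first.
  pose c := cst (2 * y)^-1 * k.
  have ec z : z = cst (2 * y)^-1 * (2 * cst y) * z.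
    by rewrite -(rmorph_nat cst 2) -!rmorphM mulVf ?rmorph1 ?mul1r // mulf_neq0.
  have -> : (X - cst x) * k = 1 * (c * (X - cst x)) * (Y - cst (- y))
      + 1 * (Y - cst y) * (- c * (X - cst x)).
    rewrite [LHS]ec /c rmorphN; ring.
  apply: PhiD; apply: PhiM.
  - by exists c, 0; ring.
  - by exists 0, 1; ring.
  - by exists 0, 1; ring.
  - by exists (- c), 0; ring.
pose d := 3 * x ^+ 2 + a4%:~R.
have d0 : d != 0.
  apply: contra_neq ns => d0; apply: (@intr_inj rat).
  rewrite y0 expr0n /= in hy.
  have e4 : a4%:~R = - (3 * x ^+ 2) :> rat by apply/eqP; rewrite -addr_eq0 addrC -/d d0.
  have e6 : a6%:~R = 2 * x ^+ 3 :> rat.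
    have : x ^+ 3 + a4%:~R * x + a6%:~R = 0 :> rat by [].
    by rewrite e4 => h; apply/eqP; rewrite -subr_eq0 -h; apply/eqP; ring.
  rewrite !(rmorphM, rmorphD, rmorphXn, rmorphN) /= e4 e6. ring.
pose c := cst d^-1 * k.
have ec z : z = cst d^-1 * (3 * cst x ^+ 2 + cst a4%:~R) * z.
  by rewrite -(rmorph_nat cst 3) -rmorphXn -rmorphM -rmorphD -rmorphM mulVf ?rmorph1
    ?mul1r.
(* Taylor expansion at the root x: f = f'(x) (X - x) + (X + 2 x) (X - x)^2. *)
pose q := X + 2 * cst x.
have -> : (X - cst x) * k = 1 * (c * (Y - cst y)) * (Y - cst (- y))
      + 1 * (X - cst x) * (- c * q * (X - cst x)).
  have e : (Y - cst y) * (Y - cst (- y)) = Y ^+ 2 - cst y ^+ 2 by rewrite rmorphN; ring.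
  transitivity (c * ((Y - cst y) * (Y - cst (- y))) - c * q * (X - cst x) ^+ 2);
    last by ring.
  rewrite e Yc_sqr cy.
  rewrite [LHS]ec /c /q; ring.
apply: PhiD; apply: PhiM.
- by exists 0, c; ring.
- by exists 0, 1; ring.
- by exists 1, 0; ring.
- by exists (- c * q), 0; ring.
Qed.

(* The line of slope s through the two points meets the curve again at
   x3 = s^2 - x1 - x2; the last two equations compare the coefficients of
   f - (line)^2 and (X - x1) (X - x2) (X - x3). *)
Definition secant (x1 y1 x2 y2 s : rat) : Prop :=
  [/\ y2 = y1 + s * (x2 - x1),
      a4%:~R = 2 * s * (y1 - s * x1) + x1 * x2 + (x1 + x2) * (s ^+ 2 - x1 - x2)
    & a6%:~R = (y1 - s * x1) ^+ 2 - x1 * x2 * (s ^+ 2 - x1 - x2)].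

Lemma secant_factor x1 y1 x2 y2 s :
  secant x1 y1 x2 y2 s -> let l := cst (y1 - s * x1) + cst s * X in
  (Y - l) * (Y + l) = (X - cst x1) * (X - cst x2) * (X - cst (s ^+ 2 - x1 - x2)).
Proof.
move=> [_ e4 e6] l; rewrite -subr_sqr Yc_sqr e4 e6 /l; ring.
Qed.

Definition ecslope (x1 y1 x2 y2 : rat) : rat :=
  if x1 == x2 then (3 * x1 ^+ 2 + a4%:~R) / (2 * y1) else (y2 - y1) / (x2 - x1).

Lemma ecslopeP x1 y1 x2 y2 :
  EQ a4 a6 (Some (x1, y1)) -> EQ a4 a6 (Some (x2, y2)) ->
  ~~ ((x1 == x2) && (y1 == - y2)) ->
  secant x1 y1 x2 y2 (ecslope x1 y1 x2 y2) /\ (x1 = x2 -> y1 = y2 /\ y1 != 0).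
Proof.
rewrite /EQ /ecslope /= => h1 h2.
have [e12 /= ny|n12 _] := eqVneq x1 x2.
  have /eqP : (y1 - y2) * (y1 + y2) = 0 by rewrite -subr_sqr h1 h2 e12 subrr.
  rewrite mulf_eq0 subr_eq0 addr_eq0 (negPf ny) orbF => /eqP ey.
  have y0 : y1 != 0.
    by apply: contra ny => /eqP y0; rewrite -ey y0 oppr0.
  split=> //; split; rewrite -?e12 -?ey.
  - by rewrite subrr mulr0 addr0.
  - by field.
  - have -> : a6%:~R = y1 ^+ 2 - x1 ^+ 3 - a4%:~R * x1 by rewrite h1; ring.
    by field.
have d0 : x2 - x1 != 0 by rewrite subr_eq0 eq_sym.
have e4 : a4%:~R = (y2 ^+ 2 - y1 ^+ 2 - x2 ^+ 3 + x1 ^+ 3) / (x2 - x1).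
  by rewrite h1 h2; field.
have e6 : a6%:~R = y1 ^+ 2 - x1 ^+ 3 - a4%:~R * x1 by rewrite h1; ring.
split=> [|e]; last by rewrite e eqxx in n12.
split; rewrite ?e6 ?e4; by field.
Qed.

(** With l the secant and m its reflection, the ideals are (X - x1, l), (X - x2, l) and (X - x3, m),
    and l m = (X - x1)(X - x2)(X - x3). The delicate point is that l lies in the product of the
    first two: the nonzero constant x2 - x1 (chord) or 2 y1 (tangent) times l is a combination of
    products of generators, up to the factor X - x3. *)
Lemma sum_rel_secant x1 y1 x2 y2 s :
  secant x1 y1 x2 y2 s -> (x1 = x2 -> y1 = y2 /\ y1 != 0) ->
  let x3 := s ^+ 2 - x1 - x2 in
  sum_rel (Some (x1, y1)) (Some (x2, y2)) (Some (x3, s * (x1 - x3) - y1))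
    (X - cst x3) (Y - cst (y1 - s * x1) - cst s * X).
Proof.
move=> sec tan x3; set l := Y - _ - _.
pose m : coord cubic := Y + cst (y1 - s * x1) + cst s * X.
have lm : l * m = (X - cst x1) * (X - cst x2) * (X - cst x3).
  by rewrite -(secant_factor sec) /l /m; ring.
have y2E : y2 - s * x2 = y1 - s * x1 by case: sec => -> _ _; ring.
have I1 g : ptideal (Some (x1, y1)) g <-> exists u w, g = u * (X - cst x1) + w * l.
  exact: ptideal_line.
have I2 g : ptideal (Some (x2, y2)) g <-> exists u w, g = u * (X - cst x2) + w * l.
  by rewrite (ptideal_line _ _ s) y2E.
have I3 g : ptideal (Some (x3, s * (x1 - x3) - y1)) g <->
    exists u w, g = u * (X - cst x3) + w * m.
  rewrite (ptideal_line _ _ (- s)).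
  have -> : Y - cst (s * (x1 - x3) - y1 - - s * x3) - cst (- s) * X = m.
    by rewrite /m; ring.
  by [].
have ml : m = l + 2 * (cst y1 + cst s * (X - cst x1)) by rewrite /m /l; ring.
clearbody l m.
split=> [g h /I1[u [w ->]] /I2[u' [w' ->]]|Phi PhiD PhiM k /I3[u [w ->]]].
  exists (u * u' * m + (X - cst x3) * (u * w' * (X - cst x1)
    + w * u' * (X - cst x2) + w * w' * l)).
    by apply/I3; exists (u * w' * (X - cst x1)
    + w * u' * (X - cst x2) + w * w' * l), (u * u'); ring.
  transitivity (u * u' * (l * m) + l * ((X - cst x3) * (u * w' * (X - cst x1)
    + w * u' * (X - cst x2) + w * w' * l))); last by ring.
  by rewrite lm; ring.
have -> : l * (u * (X - cst x3) + w * m) =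
    (X - cst x3) * (w * (X - cst x1)) * (X - cst x2) + (X - cst x3) * (u * l).
  transitivity (w * (l * m) + (X - cst x3) * (u * l)); first by ring.
  by rewrite lm; ring.
apply: (PhiD).
  apply: PhiM; [apply/I1|apply/I2].
    by exists w, 0; ring.
  by exists 1, 0; ring.
have [e12|n12] := eqVneq x1 x2; last first.
  have d0 : x2 - x1 != 0 by rewrite subr_eq0 eq_sym.
  pose c := cst (x2 - x1)^-1 * u.
  have ec z : z = cst (x2 - x1)^-1 * (cst x2 - cst x1) * z.
    by rewrite -rmorphB -rmorphM mulVf ?rmorph1 ?mul1r.
  have -> : (X - cst x3) * (u * l) = (X - cst x3) * (c * (X - cst x1)) * l
      + (X - cst x3) * (- c * l) * (X - cst x2).
    rewrite [LHS]ec /c; ring.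
  apply: (PhiD); apply: PhiM; (apply/I1 || apply/I2).
  - by exists c, 0; ring.
  - by exists 0, 1; ring.
  - by exists 0, (- c); ring.
  - by exists 1, 0; ring.
have [ey y0] := tan e12.
pose c := cst (2 * y1)^-1 * u.
have ec z : z = cst (2 * y1)^-1 * (2 * cst y1) * z.
  by rewrite -(rmorph_nat cst 2) -!rmorphM mulVf ?rmorph1 ?mul1r // mulf_neq0.
(* Expanding l m by [ml] gives 2 y1 l = (X - x1)(X - x2)(X - x3) - l^2 - 2 s l (X - x1). *)
have -> : (X - cst x3) * (u * l) =
    (X - cst x3) * (c * (X - cst x1) * (X - cst x3)) * (X - cst x2)
    + ((X - cst x3) * (- c * l) * l
    + (X - cst x3) * (- 2 * c * cst s * (X - cst x1)) * l).
  transitivity ((X - cst x3) * c * ((X - cst x1) * (X - cst x2) * (X - cst x3)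
      - l * (l + 2 * cst s * (X - cst x1)))); last by ring.
  rewrite -lm ml [LHS]ec /c; ring.
apply: (PhiD); last apply: (PhiD); apply: PhiM; (apply/I1 || apply/I2).
- by exists (c * (X - cst x3)), 0; ring.
- by exists 1, 0; ring.
- by exists 0, (- c); ring.
- by exists 0, 1; ring.
- by exists (- 2 * c * cst s), 0; ring.
- by exists 0, 1; ring.
Qed.

Lemma coord_neq0 (p q : {poly rat}) : p != 0 \/ q != 0 -> ((p, q) : coord cubic) != 0.
Proof. by rewrite xpair_eqE => -[] /negPf->; rewrite ?andbF. Qed.

Lemma ecadd_rel P Q : nonsingular a4 a6 -> EQ a4 a6 P -> EQ a4 a6 Q ->
  exists a b, [/\ a != 0, b != 0 & sum_rel P Q (ecadd a4 P Q) a b].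
Proof.
move=> ns; have n1 : (1 : coord cubic) != 0 := oner_neq0 _.
have nX x : X - cst x != 0.
  by apply: coord_neq0; left; rewrite -size_poly_gt0 size_XsubC.
case: P Q => [[x1 y1]|] [[x2 y2]|] hP hQ /=; last 3 first.
- by exists 1, 1; split=> //; apply/sum_rel_sym/sum_rel0.
- by exists 1, 1; split=> //; apply/sum_rel0.
- by exists 1, 1; split=> //; apply/sum_rel0.
case: ifPn => [/andP[/eqP e12 /eqP ey]|ne].
  exists 1, (X - cst x1); split=> //.
  have -> : y2 = - y1 by rewrite ey opprK.
  by rewrite -e12; apply: sum_rel_opp.
have [sec tan] := ecslopeP hP hQ ne.
do 2 eexists; split; last exact: (sum_rel_secant sec tan); first exact: nX.
by apply: coord_neq0; right; rewrite /= !mulr0 mul0r addr0 !subr0 oner_neq0.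
Qed.

Lemma ecadd_EQ P Q : EQ a4 a6 P -> EQ a4 a6 Q -> EQ a4 a6 (ecadd a4 P Q).
Proof.
case: P Q => [[x1 y1]|] [[x2 y2]|] //= hP hQ.
case: ifPn => // ne.
have [[_ e4 e6] _] := ecslopeP hP hQ ne.
by rewrite /EQ -/(ecslope x1 y1 x2 y2) /= e4 e6; ring.
Qed.

Lemma ecopp_EQ P : EQ a4 a6 P -> EQ a4 a6 (ecopp P).
Proof. by case: P => [[x y]|] //=; rewrite /EQ /= sqrrN. Qed.

Lemma ecaddN P : ecadd a4 P (ecopp P) = None.
Proof. by case: P => [[x y]|] //=; rewrite opprK !eqxx. Qed.

Lemma ecadd_opp_eq0 P Q : ecadd a4 P (ecopp Q) = None -> P = Q.
Proof.
case: P Q => [[x1 y1]|] [[x2 y2]|] //=; rewrite opprK.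
by case: ifP => // /andP[/eqP-> /eqP->].
Qed.

(** The hypotheses say a I_P = b I_Q. Multiplied by the ideal of - Q, the right side becomes
    principal, hence so does the ideal of P - Q, which must be the point at infinity. *)
Lemma ptideal_ext P Q a b : nonsingular a4 a6 -> EQ a4 a6 P -> EQ a4 a6 Q ->
  a != 0 -> b != 0 ->
  (forall g : coord cubic, ptideal P g -> exists2 k, ptideal Q k & a * g = b * k) ->
  (forall g : coord cubic, ptideal Q g -> exists2 k, ptideal P k & b * g = a * k) ->
  P = Q.
Proof.
move=> ns hP hQ a0 b0 hPQ hQP; apply: ecadd_opp_eq0.
have hQ' := ecopp_EQ hQ; have hS := ecadd_EQ hP hQ'.
have [c [d [c0 d0 [S1 S2]]]] := ecadd_rel ns hP hQ'.
have [e [f [e0 f0 [N1 N2]]]] := ecadd_rel ns hQ hQ'.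
rewrite ecaddN in N1 N2; move: hS S1 S2.
case: ecadd => [[x y]|] // hS S1 S2; exfalso.
(* The generator [s] corresponds to the element 1 of the unit ideal attached to Q + (- Q). *)
have [s sI es] : exists2 s : coord cubic, ptideal (Some (x, y)) s &
    c * b * (f * 1) = a * e * d * s.
  apply: (N2 (fun z => exists2 s, ptideal (Some (x, y)) s &
      c * b * z = a * e * d * s)) => //.
    move=> ? ? [s1 I1 e1] [s2 I2 e2].
    by exists (s1 + s2); [apply: ptidealD|rewrite !mulrDr e1 e2].
  move=> g h Qg Qh; have [g' Pg' eg] := hQP _ Qg.
  have [k Sk ek] := S1 _ _ Pg' Qh; exists k => //.
  transitivity (c * e * (b * g) * h); first by ring.
  rewrite eg; transitivity (a * e * (c * g' * h)); first by ring.
  by rewrite ek; ring.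
apply: (@ptideal_principal _ size_cubic x y s); first by rewrite cubicE.
split=> // k Sk.
have [u eu] : exists u, a * e * (d * k) = c * b * f * u.
  apply: (S2 (fun z => exists u, a * e * z = c * b * f * u)) => //.
    move=> ? ? [u1 e1] [u2 e2].
    by exists (u1 + u2); rewrite !mulrDr e1 e2.
  move=> g h Pg Qh; have [g' Qg' eg] := hPQ _ Pg.
  have [u _ eu] := N1 _ _ Qg' Qh; exists u.
  transitivity (c * e * (a * g) * h); first by ring.
  rewrite eg; transitivity (b * c * (e * g' * h)); first by ring.
  by rewrite eu; ring.
exists u; apply: (coord_mulI size_cubic (g := a * e * d)).
  by do 2?apply: coord_mulf_neq0 => //; exact: size_cubic.
rewrite -mulrA eu -[f]mulr1 es; ring.
Qed.

(** The ideals of both sums are proportional to the same product of ideals, so [ptideal_ext]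
    applies. *)
Lemma ecaddC P Q : nonsingular a4 a6 -> EQ a4 a6 P -> EQ a4 a6 Q ->
  ecadd a4 P Q = ecadd a4 Q P.
Proof.
move=> ns hP hQ.
have [a [b [a0 b0 R1]]] := ecadd_rel ns hP hQ.
have [c [d [c0 d0 R2]]] := ecadd_rel ns hQ hP.
have key (S T : ecpoint) (U V : ecpoint) a' b' c' d' :
    sum_rel U V S a' b' -> sum_rel U V T c' d' ->
    forall g, ptideal S g -> exists2 k, ptideal T k & b' * c' * g = a' * d' * k.
  move=> [_ h2] [h1 _] g Sg.
  have [k Tk e] : exists2 k, ptideal T k & c' * (b' * g) = a' * d' * k.
    apply: (h2 (fun z => exists2 k, ptideal T k & c' * z = a' * d' * k)) => //.
      move=> ? ? [k1 I1 e1] [k2 I2 e2].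
      by exists (k1 + k2); [apply: ptidealD|rewrite !mulrDr e1 e2].
    move=> u v Uu Vv; have [k Tk ek] := h1 _ _ Uu Vv.
    exists k => //; transitivity (a' * (c' * u * v)); first by ring.
    by rewrite ek; ring.
  by exists k => //; rewrite -e; ring.
have nz := coord_mulf_neq0 size_cubic.
apply: (@ptideal_ext _ _ (b * c) (a * d)) => //.
- exact: ecadd_EQ.
- exact: ecadd_EQ.
- exact: nz.
- exact: nz.
- exact: key R1 (sum_rel_sym R2).
- by move=> g /(key _ _ _ _ _ _ _ _ (sum_rel_sym R2) R1)[k Pk e]; exists k;
    rewrite // (mulrC a) (mulrC b) e.
Qed.

(** Both sides have ideals proportional to I_P I_Q I_S; this replaces the case distinction between
    chords and tangents. *)
Lemma ecaddA P Q S : nonsingular a4 a6 ->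
  EQ a4 a6 P -> EQ a4 a6 Q -> EQ a4 a6 S ->
  ecadd a4 P (ecadd a4 Q S) = ecadd a4 (ecadd a4 P Q) S.
Proof.
move=> ns hP hQ hS.
have key (P1 P2 P3 P12 P23 T T' : ecpoint) a1 b1 a2 b2 a3 b3 a4' b4 :
    sum_rel P1 P2 P12 a1 b1 -> sum_rel P12 P3 T a2 b2 ->
    sum_rel P2 P3 P23 a3 b3 -> sum_rel P1 P23 T' a4' b4 ->
    forall g, ptideal T g ->
    exists2 k, ptideal T' k & a3 * a4' * (b1 * b2) * g = a1 * a2 * (b3 * b4) * k.
  move=> [_ r1] [_ r2] [r3 _] [r4 _] g Tg.
  pose Phi w z := exists2 k, ptideal T' k &
    w * z = a1 * a2 * (b3 * b4) * k.
  have PhiD w u v : Phi w u -> Phi w v -> Phi w (u + v).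
    move=> [k1 I1 e1] [k2 I2 e2].
    by exists (k1 + k2); [apply: ptidealD|rewrite !mulrDr e1 e2].
  have [k Tk e] : Phi (a3 * a4' * b1) (b2 * g).
    apply: r2 Tg => [u v|u v P12u P3v]; first exact: PhiD.
    have [k Tk e] : Phi (a3 * a4' * a2 * v) (b1 * u).
      apply: r1 P12u => [w z|w z P1w P2z]; first exact: PhiD.
      have [k P23k e] := r3 _ _ P2z P3v.
      have [k' Tk' e'] := r4 _ _ P1w P23k.
      exists k' => //.
      transitivity (a1 * a2 * a4' * w * (a3 * z * v)); first by ring.
      rewrite e; transitivity (a1 * a2 * b3 * (a4' * w * k)); first by ring.
      by rewrite e'; ring.
    by exists k => //; rewrite -e; ring.
  by exists k => //; rewrite -e; ring.
have hPQ := ecadd_EQ hP hQ; have hQS := ecadd_EQ hQ hS.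
have [a1 [b1 [? ? r1]]] := ecadd_rel ns hP hQ.
have [a2 [b2 [? ? r2]]] := ecadd_rel ns hPQ hS.
have [a3 [b3 [? ? r3]]] := ecadd_rel ns hQ hS.
have [a5 [b5 [? ? r5]]] := ecadd_rel ns hP hQS.
have nz := coord_mulf_neq0 size_cubic.
apply/esym/(@ptideal_ext _ _ (a3 * a5 * (b1 * b2)) (a1 * a2 * (b3 * b5))) => //.
- exact: ecadd_EQ.
- exact: ecadd_EQ.
- by rewrite !nz.
- by rewrite !nz.
- exact: key r1 r2 r3 r5.
move=> g Tg.
(* The converse inclusion is the same statement for the points in the order S, Q, P. *)
have [k Tk e] := key _ _ _ _ _ _ _ _ _ _ _ _ _ _ _ (sum_rel_sym r3)
  (sum_rel_sym r5) (sum_rel_sym r1) (sum_rel_sym r2) _ Tg.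
by exists k.
Qed.
End GroupLaw.

(** * The points of the curve as an abelian group *)

Section PointGroup.
Variables (a4 a6 : int) (ns : nonsingular a4 a6).

Definition oncurve (P : ecpoint) : bool :=
  if P is Some (x, y) then y ^+ 2 == x ^+ 3 + a4%:~R * x + a6%:~R else true.

Lemma oncurveP P : reflect (EQ a4 a6 P) (oncurve P).
Proof. by case: P => [[x y]|]; [exact: eqP|left]. Qed.

(** The proof of nonsingularity is a parameter of the type, so that the group structure, which
    depends on it, can be attached as an instance. *)
Definition ecgroup of nonsingular a4 a6 : Type := {P : ecpoint | oncurve P}.
Local Notation G := (ecgroup ns).

HB.instance Definition _ := Choice.copy G {P : ecpoint | oncurve P}.

Definition ecpt : G -> ecpoint := fun P => sval P.

Lemma ecptP (P : G) : EQ a4 a6 (ecpt P).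
Proof. by apply/oncurveP; case: P. Qed.

Definition mkpt (P : ecpoint) (hP : EQ a4 a6 P) : G :=
  exist _ P (introT (oncurveP P) hP).

Lemma ecpt_inj : injective ecpt.
Proof. exact: val_inj. Qed.

Definition gadd (P Q : G) : G := mkpt (ecadd_EQ (ecptP P) (ecptP Q)).
Definition gopp (P : G) : G := mkpt (ecopp_EQ (ecptP P)).
Definition gzero : G := @mkpt None I.

Fact gaddA : associative gadd.
Proof. by move=> P Q S; apply/ecpt_inj/(ecaddA ns); exact: ecptP. Qed.
Fact gaddC : commutative gadd.
Proof. by move=> P Q; apply/ecpt_inj/(ecaddC ns); exact: ecptP. Qed.
Fact gadd0 : left_id gzero gadd.
Proof. by move=> P; apply/ecpt_inj. Qed.
Fact gaddN : left_inverse gzero gopp gadd.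
Proof. by move=> P; rewrite gaddC; apply/ecpt_inj/ecaddN. Qed.

HB.instance Definition _ := GRing.isZmodule.Build G gaddA gaddC gadd0 gaddN.

Lemma ecptD (P Q : G) : ecpt (P + Q) = ecadd a4 (ecpt P) (ecpt Q).
Proof. by []. Qed.

Lemma ecptN (P : G) : ecpt (- P) = ecopp (ecpt P).
Proof. by []. Qed.

Lemma ecpt0 : ecpt (0 : G) = None.
Proof. by []. Qed.

Lemma ecptMn (P : G) n : ecpt (P *+ n) = ecmuln a4 n (ecpt P).
Proof.
rewrite /ecmuln; elim: n => [|n IH]; first by rewrite mulr0n.
by rewrite mulrS ecptD IH.
Qed.

Lemma EtorP (P : G) : Etor a4 a6 (ecpt P) <-> exists2 n, (0 < n)%N & P *+ n = 0.
Proof.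
split=> [[_ [n n0 e]]|[n n0 e]].
  by exists n => //; apply: ecpt_inj; rewrite ecptMn.
by split; [exact: ecptP|exists n; rewrite // -ecptMn e].
Qed.
End PointGroup.

(** * Naive heights *)

Definition qheight (x : rat) : int := Num.max `|numq x| (denq x).

Lemma qheight_ge1 x : 1 <= qheight x.
Proof. by rewrite le_max -(gtz0_ge1 (denq x)) denq_gt0 orbT. Qed.

Lemma frac_lowest (n m : int) : m != 0 ->
  exists k : int, [/\ k != 0, n = numq (n%:~R / m%:~R) * k
    & m = denq (n%:~R / m%:~R) * k].
Proof.
move=> m0; set x : rat := n%:~R / m%:~R.
have mq0 : m%:~R != 0 :> rat by rewrite intr_eq0.
have dq0 : (denq x)%:~R != 0 :> rat by rewrite intr_eq0 denq_neq0.
have cross : n * denq x = numq x * m.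
  apply: (@intr_inj rat); rewrite !rmorphM /=.
  have -> : n%:~R = x * m%:~R :> rat by rewrite /x mulfVK.
  by rewrite -{1}[x]divq_num_den; field.
have /dvdzP[k mk] : (denq x %| m)%Z.
  rewrite -(@Gauss_dvdzr _ (numq x)) -?cross ?dvdz_mull //.
  by rewrite coprimez_sym; exact: coprime_num_den.
have k0 : k != 0 by apply: contraNneq m0 => k0; rewrite mk k0 mul0r.
exists k; split=> //; last by rewrite mk mulrC.
apply: (mulIf (denq_neq0 x)); rewrite cross mk; ring.
Qed.

(** The height drops exactly by the factor that cancels, so a bound on common divisors gives a lower
    bound for the height. *)
Lemma qheight_frac (n m : int) : m != 0 ->
  exists k : int, [/\ (k %| n)%Z, (k %| m)%Z, k != 0
    & Num.max `|n| `|m| = `|k| * qheight (n%:~R / m%:~R)].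
Proof.
move=> m0; have [k [k0 en em]] := frac_lowest n m0.
exists k; split=> //; first by rewrite en dvdz_mull.
  by rewrite em dvdz_mull.
move: en em; set x : rat := n%:~R / m%:~R; clearbody x => -> ->.
by rewrite !normrM /qheight (gtr0_norm (denq_gt0 _)) -maxr_pMl // mulrC.
Qed.

Lemma qheight_frac_le (n m : int) : m != 0 ->
  qheight (n%:~R / m%:~R) <= Num.max `|n| `|m|.
Proof.
move=> m0; have [k [_ _ k0 ->]] := qheight_frac n m0.
rewrite ler_peMl //; first by apply: le_trans (qheight_ge1 _).
by rewrite -gtz0_ge1 normr_gt0.
Qed.

(* Gauss's lemma for (b X - a)(d X - c). *)
Lemma primitive_quadratic (a b c d w : int) : coprimez a b -> coprimez c d ->
  (b * d %| w * (a * d + b * c))%Z -> (b * d %| w * (a * c))%Z ->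
  d != 0 -> b != 0 -> (b * d %| w)%Z.
Proof.
have gauss (p q m : int) : coprimez q p -> (p %| m * q)%Z -> (p %| m)%Z.
  by rewrite coprimez_sym => /Gauss_dvdzl->.
have combine (p m q r : int) : coprimez q r ->
    (p %| m * q)%Z -> (p %| m * r)%Z -> (p %| m)%Z.
  move=> /coprimezP[[u v] /= e] /dvdzP[z1 e1] /dvdzP[z2 e2].
  apply/dvdzP; exists (u * z1 + v * z2).
  by rewrite -[LHS]mulr1 -e !mulrDr !mulrDl -!mulrA -e1 -e2; ring.
move=> cab ccd /dvdzP[z1 h1] /dvdzP[z2 h2] d0 b0.
have /dvdzP[w1 ew] : (b %| w)%Z.
  apply: (combine _ _ c d) => //; apply: (gauss _ a) => //; apply/dvdzP.
    by exists (z2 * d); rewrite -mulrA (mulrC c) h2; ring.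
  exists (z1 * d - w * c); rewrite mulrBl -!mulrA (mulrC d b) -h1; ring.
have k1 : w1 * (a * d + b * c) = z1 * d.
  by apply: (mulIf b0); rewrite mulrAC -ew h1; ring.
have k2 : w1 * (a * c) = z2 * d.
  by apply: (mulIf b0); rewrite mulrAC -ew h2; ring.
have /dvdzP[z ez] : (d %| w1)%Z.
  apply: (combine _ _ a b) => //; apply: (gauss _ c) => //; apply/dvdzP.
    by exists z2; rewrite -k2; ring.
  by exists (z1 - w1 * a); rewrite mulrBl -k1; ring.
by apply/dvdzP; exists z; rewrite ew ez; ring.
Qed.

Lemma normM_le (R : numDomainType) (x y p q : R) :
  `|x| <= p -> `|y| <= q -> `|x * y| <= p * q.
Proof. by move=> hx hy; rewrite normrM ler_pM. Qed.

Lemma normD_le (R : numDomainType) (x y p q : R) :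
  `|x| <= p -> `|y| <= q -> `|x + y| <= p + q.
Proof. by move=> hx hy; rewrite (le_trans (ler_normD _ _)) // lerD. Qed.

Lemma normB_le (R : numDomainType) (x y p q : R) :
  `|x| <= p -> `|y| <= q -> `|x - y| <= p + q.
Proof. by move=> hx hy; rewrite normD_le // normrN. Qed.

(** Write x = a / b and y = c / d. By Gauss's lemma b d divides w, so |a d + b c|, |a c| and b d are
    at most M. The mixed terms |a| d and b |c| differ by at most M and have product at most M^2, so
    neither exceeds 2 M. *)
Lemma qheight_sum_prod (x y : rat) (s t w M : int) : w != 0 ->
  x + y = s%:~R / w%:~R -> x * y = t%:~R / w%:~R ->
  `|s| <= M -> `|t| <= M -> `|w| <= M -> qheight x * qheight y <= 2 * M.
Proof.
move=> w0 hs ht sM tM wM.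
have wq0 : w%:~R != 0 :> rat by rewrite intr_eq0.
have xE : x = (numq x)%:~R / (denq x)%:~R by rewrite divq_num_den.
have yE : y = (numq y)%:~R / (denq y)%:~R by rewrite divq_num_den.
have bq0 : (denq x)%:~R != 0 :> rat by rewrite intr_eq0 denq_neq0.
have dq0 : (denq y)%:~R != 0 :> rat by rewrite intr_eq0 denq_neq0.
have cab : coprimez (numq x) (denq x) by exact: coprime_num_den.
have ccd : coprimez (numq y) (denq y) by exact: coprime_num_den.
have b0 := denq_gt0 x; have d0 := denq_gt0 y.
rewrite /qheight; move: (numq x) (denq x) (numq y) (denq y) xE yE bq0 dq0 cab ccd b0 d0.
move=> a b c d xE yE bq0 dq0 cab ccd b0 d0.
have es : s * (b * d) = w * (a * d + b * c).
  apply: (@intr_inj rat); rewrite !(rmorphM, rmorphD) /=.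
  have -> : s%:~R = (x + y) * w%:~R :> rat by rewrite hs mulfVK.
  by rewrite xE yE; field; rewrite bq0 dq0.
have et : t * (b * d) = w * (a * c).
  apply: (@intr_inj rat); rewrite !rmorphM /=.
  have -> : t%:~R = (x * y) * w%:~R :> rat by rewrite ht mulfVK.
  by rewrite xE yE; field; rewrite bq0 dq0.
have /dvdzP[z ez] : (b * d %| w)%Z.
  apply: (primitive_quadratic cab ccd); rewrite ?gt_eqF // -?es -?et;
  by rewrite dvdz_mull.
have bd0 : b * d != 0 by rewrite mulf_neq0 // gt_eqF.
have z0 : z != 0 by apply: contraNneq w0 => z0; rewrite ez z0 mul0r.
have sz : s = z * (a * d + b * c).
  by apply: (mulIf bd0); rewrite es ez; ring.
have tz : t = z * (a * c) by apply: (mulIf bd0); rewrite et ez; ring.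
have zge (m : int) : `|m| <= `|z * m|.
  by rewrite normrM ler_peMl // -gtz0_ge1 normr_gt0.
have h1 : `|a * d + b * c| <= M by apply: le_trans sM; rewrite sz.
have h2 : `|a| * `|c| <= M by rewrite -normrM; apply: le_trans tM; rewrite tz.
have h3 : b * d <= M.
  have -> : b * d = `|b * d| by rewrite gtr0_norm // mulr_gt0.
  by apply: le_trans wM; rewrite ez.
have M0 : 0 <= M by apply: le_trans sM.
have mixed (p q : int) : 0 <= p -> 0 <= q -> p - q <= M -> q - p <= M ->
    p * q = (`|a| * `|c|) * (b * d) -> p <= 2 * M.
  move=> p0 q0 pq qp epq; rewrite leNgt; apply/negP => lt.
  have : p * q <= M * M by rewrite epq ler_pM // ?mulr_ge0 // ltW.
  have : M + 1 <= q by lia.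
  have : 2 * M + 1 <= p by lia.
  by move: M0; clear; nia.
have adE : `|a| * d = `|a * d| by rewrite normrM (gtr0_norm d0).
have bcE : b * `|c| = `|b * c| by rewrite normrM (gtr0_norm b0).
have dist1 : `|a| * d - b * `|c| <= M by rewrite adE bcE; move: h1; clear; lia.
have dist2 : b * `|c| - `|a| * d <= M by rewrite adE bcE; move: h1; clear; lia.
have ad0 : 0 <= `|a| * d by rewrite mulr_ge0 // ltW.
have bc0 : 0 <= b * `|c| by rewrite mulr_ge0 // ltW.
have m1 : `|a| * d <= 2 * M.
  by apply: (mixed _ (b * `|c|)) => //; ring.
have m2 : b * `|c| <= 2 * M.
  by apply: (mixed _ (`|a| * d)) => //; ring.
have b0' := ltW b0.
rewrite maxr_pMl ?le_max ?normr_ge0 // !maxr_pMr // !ge_max m1 m2 andbT /=.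
by move: h2 h3 M0; clear; lia.
Qed.

(** * Heights of the sum and the difference of two points *)

Section HeightBounds.
Variables a4 a6 : int.

(** [x3] and [x4] belong to P + Q and P - Q. Replacing y2 by - y2 exchanges them, so their symmetric
    functions depend only on x1, x2 and the coefficients. *)
Lemma secant_sum_prod (x1 y1 x2 y2 : rat) : x1 != x2 ->
  EQ a4 a6 (Some (x1, y1)) -> EQ a4 a6 (Some (x2, y2)) ->
  let x3 := ((y2 - y1) / (x2 - x1)) ^+ 2 - x1 - x2 in
  let x4 := ((- y2 - y1) / (x2 - x1)) ^+ 2 - x1 - x2 in
  x3 + x4 = 2 * ((x1 + x2) * (a4%:~R + x1 * x2) + 2 * a6%:~R) / (x1 - x2) ^+ 2
  /\ x3 * x4 = ((x1 * x2 - a4%:~R) ^+ 2 - 4 * a6%:~R * (x1 + x2)) / (x1 - x2) ^+ 2.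
Proof.
rewrite /EQ /= => n12 h1 h2.
have d0 : x2 - x1 != 0 by rewrite subr_eq0 eq_sym.
have d0' : x1 - x2 != 0 by rewrite subr_eq0.
have e4 : a4%:~R = (y2 ^+ 2 - y1 ^+ 2 - x2 ^+ 3 + x1 ^+ 3) / (x2 - x1).
  by rewrite h1 h2; field.
have e6 : a6%:~R = y1 ^+ 2 - x1 ^+ 3 - a4%:~R * x1 by rewrite h1; ring.
by split; rewrite e6 e4; field; rewrite d0 d0'.
Qed.

Definition coefbound : int := 1 + `|a4| + `|a6|.

Lemma naive_height_add_sub (x1 y1 x2 y2 : rat) : x1 != x2 ->
  EQ a4 a6 (Some (x1, y1)) -> EQ a4 a6 (Some (x2, y2)) ->
  naive_height (ecadd a4 (Some (x1, y1)) (Some (x2, y2)))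
    * naive_height (ecadd a4 (Some (x1, y1)) (Some (x2, - y2)))
  <= 18 * coefbound ^+ 2 * (qheight x1 * qheight x2) ^+ 2.
Proof.
move=> n12 hP hQ; have [hs ht] := secant_sum_prod n12 hP hQ.
rewrite /= (negPf n12) /=; set x3 := _ - x2 in hs ht *; set x4 := _ - x2 in hs ht *.
rewrite -!/(qheight _).
have x1E : x1 = (numq x1)%:~R / (denq x1)%:~R by rewrite divq_num_den.
have x2E : x2 = (numq x2)%:~R / (denq x2)%:~R by rewrite divq_num_den.
have dq0 : (denq x1)%:~R != 0 :> rat by rewrite intr_eq0 denq_neq0.
have eq0 : (denq x2)%:~R != 0 :> rat by rewrite intr_eq0 denq_neq0.
have hA : `|numq x1| <= qheight x1 by rewrite le_max lexx.
have hd : `|denq x1| <= qheight x1 by rewrite le_max (gtr0_norm (denq_gt0 _)) lexx orbT.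
have hB : `|numq x2| <= qheight x2 by rewrite le_max lexx.
have he : `|denq x2| <= qheight x2 by rewrite le_max (gtr0_norm (denq_gt0 _)) lexx orbT.
move: (qheight x1) (qheight x2) hA hd hB he => H1 H2 hA hd hB he.
move: (numq x1) (denq x1) (numq x2) (denq x2) x1E x2E dq0 eq0 hA hd hB he.
move=> a d b e x1E x2E dq0 eq0 hA hd hB he.
have bu := normM_le hA he; have bv := normM_le hd hB.
have bw := normM_le hA hB; have bz := normM_le hd he.
set h := H1 * H2 in bu bv bw bz *.
have h0 : 0 <= h by apply: le_trans bu.
have -> : 18 * coefbound ^+ 2 * h ^+ 2 = 2 * (9 * coefbound ^+ 2 * h ^+ 2) by ring.
have c1 : 1 <= coefbound by rewrite /coefbound; lia.
have a4c : 1 + `|a4| <= coefbound by rewrite /coefbound; lia.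
have a6c : `|a6| <= coefbound by rewrite /coefbound; lia.
have h2 : 0 <= h ^+ 2 by apply: sqr_ge0.
(* The fractions of [secant_sum_prod], cleared of denominators by (d e)^2. With c = [coefbound], the
   bounds for [s], [t], [w] are 4 c h^2, (c^2 + 8 c) h^2 and 4 h^2, all within 9 c^2 h^2. *)
pose w := (a * e - d * b) ^+ 2.
pose s := 2 * ((a * e + d * b) * (a4 * (d * e) + a * b) + 2 * a6 * ((d * e) * (d * e))).
pose t := (a * b - a4 * (d * e)) * (a * b - a4 * (d * e))
  - 4 * a6 * ((a * e + d * b) * (d * e)).
have w0 : w%:~R != 0 :> rat.
  rewrite /w rmorphXn expf_neq0 // rmorphB !rmorphM /= subr_eq0.
  apply: contra n12 => /eqP ee; rewrite x1E x2E; apply/eqP.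
  by apply: (mulIf dq0); apply: (mulIf eq0); rewrite mulfVK // ee; field; rewrite eq0.
have de0 : a%:~R * e%:~R - d%:~R * b%:~R != 0 :> rat.
  by apply: contra w0 => /eqP ee; rewrite /w rmorphXn rmorphB !rmorphM /= ee expr0n.
apply: (@qheight_sum_prod x3 x4 s t w).
- by apply: contra w0 => /eqP ->.
- rewrite hs /s /w !(rmorphM, rmorphD, rmorphB, rmorphXn) /= x1E x2E; field.
  by rewrite dq0 eq0 de0.
- rewrite ht /t /w !(rmorphM, rmorphD, rmorphB, rmorphXn) /= x1E x2E; field.
  by rewrite dq0 eq0 de0.
- have := normM_le (lexx `|2|) (normD_le (normM_le (normD_le bu bv)
    (normD_le (normM_le (lexx `|a4|) bz) bw))
    (normM_le (normM_le (lexx `|2|) (lexx `|a6|)) (normM_le bz bz))).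
  rewrite -/s => /le_trans; apply.
  have -> : `|2 : int| * ((h + h) * (`|a4| * h + h) + `|2 : int| * `|a6| * (h * h)) =
     4 * coefbound * h ^+ 2.
    by rewrite /coefbound (ger0_norm (_ : 0 <= 2 :> int)) //; ring.
  rewrite ler_wpM2r //; move: c1; clear; nia.
- have b1 := normB_le bw (normM_le (lexx `|a4|) bz).
  have := normB_le (normM_le b1 b1) (normM_le (normM_le (lexx `|4|) (lexx `|a6|))
    (normM_le (normD_le bu bv) bz)).
  rewrite -/t => /le_trans; apply.
  have -> : (h + `|a4| * h) * (h + `|a4| * h) + `|4 : int| * `|a6| * ((h + h) * h) =
     ((1 + `|a4|) ^+ 2 + 8 * `|a6|) * h ^+ 2.
    by rewrite (ger0_norm (_ : 0 <= 4 :> int)) //; ring.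
  rewrite ler_wpM2r //.
  have : 0 <= `|a4| by [].
  by move: a4c a6c c1; move: coefbound `|a4| `|a6|; clear; nia.
- have := normM_le (normB_le bu bv) (normB_le bu bv).
  rewrite -/(_ ^+ 2) -/w => /le_trans; apply.
  have -> : (h + h) * (h + h) = 4 * h ^+ 2 by ring.
  rewrite ler_wpM2r //; move: c1; clear; nia.
Qed.
End HeightBounds.

(* A homogeneous form of degree n, given by the list of its pairs
   (coefficient, exponent of the first variable). *)
Definition hform (n : nat) (l : seq (int * nat)) (a d : int) : int :=
  foldr (fun ci acc => ci.1 * (a ^+ ci.2 * d ^+ (n - ci.2)) + acc) 0 l.

Lemma hform_bound n l : all (fun ci => ci.2 <= n)%N l ->
  exists2 C : int, 0 <= C & forall a d H : int, `|a| <= H -> `|d| <= H ->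
    `|hform n l a d| <= C * H ^+ n.
Proof.
elim: l => [_|[c i] l IH /= /andP[hi /IH[C C0 hC]]].
  by exists 0 => // a d H _ _; rewrite normr0 mul0r.
exists (`|c| + C) => [|a d H ha hd]; first by rewrite addr_ge0.
rewrite mulrDl normD_le ?hC // normM_le //.
by rewrite -{2}(subnKC hi) exprD normM_le // normrX lerXn2r // nnegrE // (le_trans _ ha).
Qed.

(** * The duplication formula and the cancellation in it *)

Section Duplication.
Variables a4 a6 : int.

(* x(2 P) = dup_num / dup_den for x(P) = a / d. *)
Definition dup_num :=
  hform 4 [:: (1, 4%N); (- 2 * a4, 2%N); (- 8 * a6, 1%N); (a4 ^+ 2, 0%N)].
Definition dup_den := hform 4 [:: (4, 3%N); (4 * a4, 1%N); (4 * a6, 0%N)].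

Let disc : int := 4 * (4 * a4 ^+ 3 + 27 * a6 ^+ 2).
(* The cofactors of the Bezout identities for the duplication formula, from
   Silverman, The Arithmetic of Elliptic Curves, VIII.4.3. *)
Let f1 := hform 3 [:: (12, 2%N); (16 * a4, 0%N)].
Let g1 := hform 3 [:: (3, 3%N); (- 5 * a4, 1%N); (- 27 * a6, 0%N)].
Let f2 := hform 3 [:: (disc, 3%N); (- 4 * a4 ^+ 2 * a6, 2%N);
  (4 * a4 * (3 * a4 ^+ 3 + 22 * a6 ^+ 2), 1%N);
  (12 * a6 * (a4 ^+ 3 + 8 * a6 ^+ 2), 0%N)].
Let g2 := hform 3 [:: (a4 ^+ 2 * a6, 3%N);
  (a4 * (5 * a4 ^+ 3 + 32 * a6 ^+ 2), 2%N);
  (2 * a6 * (13 * a4 ^+ 3 + 96 * a6 ^+ 2), 1%N);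
  (- 3 * a4 ^+ 2 * (a4 ^+ 3 + 8 * a6 ^+ 2), 0%N)].

Lemma dup_bezout1 a d : f1 a d * dup_num a d - g1 a d * dup_den a d = disc * d ^+ 7.
Proof. by rewrite /f1 /g1 /dup_num /dup_den /disc /hform /= ?subn0 ?subSS; ring. Qed.

Lemma dup_bezout2 a d : f2 a d * dup_num a d + g2 a d * dup_den a d = disc * a ^+ 7.
Proof. by rewrite /f2 /g2 /dup_num /dup_den /disc /hform /= ?subn0 ?subSS; ring. Qed.

Lemma disc_neq0 : nonsingular a4 a6 -> disc != 0.
Proof.
by rewrite /nonsingular /disc mulf_eq0 /= => h; rewrite mulf_neq0.
Qed.

(** Since a^7 and d^7 are coprime, the two Bezout identities combine to express [disc] through the
    two forms. *)
Lemma dup_common a d k : coprimez a d ->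
  (k %| dup_num a d)%Z -> (k %| dup_den a d)%Z -> (k %| disc)%Z.
Proof.
move=> cop /dvdzP kn /dvdzP kd.
have cop7 : coprimez (a ^+ 7) (d ^+ 7) by rewrite coprimezXl // coprimezXr.
have /coprimezP[[u v] /= e] := cop7.
have -> : disc = u * (disc * a ^+ 7) + v * (disc * d ^+ 7).
  by rewrite -[LHS]mulr1 -e; ring.
rewrite -(dup_bezout1 a d) -(dup_bezout2 a d).
have [p ->] := kn; have [q ->] := kd.
apply/dvdzP; exists ((u * f2 a d + v * f1 a d) * p + (u * g2 a d - v * g1 a d) * q).
ring.
Qed.

(** With H and M the two maxima, the Bezout identity for the larger of |a| and |d| gives H^7 <= C
    H^3 M, because |[disc]| >= 1 and the cofactors are cubic forms; then H^3 cancels. *)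
Lemma dup_lower : nonsingular a4 a6 -> exists2 C : int, 0 < C &
  forall a d : int, d != 0 -> Num.max `|a| `|d| ^+ 4 <=
    C * Num.max `|dup_num a d| `|dup_den a d|.
Proof.
move=> ns; have d0 := disc_neq0 ns.
have [//|Cf1 f10 bf1] := @hform_bound 3 [:: (12, 2%N); (16 * a4, 0%N)].
have [//|Cg1 g10 bg1] := @hform_bound 3 [:: (3, 3%N); (- 5 * a4, 1%N); (- 27 * a6, 0%N)].
have [//|Cf2 f20 bf2] := @hform_bound 3 [:: (disc, 3%N); (- 4 * a4 ^+ 2 * a6, 2%N);
  (4 * a4 * (3 * a4 ^+ 3 + 22 * a6 ^+ 2), 1%N);
  (12 * a6 * (a4 ^+ 3 + 8 * a6 ^+ 2), 0%N)].
have [//|Cg2 g20 bg2] := @hform_bound 3 [:: (a4 ^+ 2 * a6, 3%N);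
  (a4 * (5 * a4 ^+ 3 + 32 * a6 ^+ 2), 2%N);
  (2 * a6 * (13 * a4 ^+ 3 + 96 * a6 ^+ 2), 1%N);
  (- 3 * a4 ^+ 2 * (a4 ^+ 3 + 8 * a6 ^+ 2), 0%N)].
exists (1 + Cf1 + Cg1 + Cf2 + Cg2); first by lia.
move=> a d dn0; set H := Num.max `|a| `|d|; set M := Num.max `|dup_num a d| _.
have ha : `|a| <= H by rewrite le_max lexx.
have hd : `|d| <= H by rewrite le_max lexx orbT.
have H0 : 0 < H by rewrite (lt_le_trans _ hd) // normr_gt0.
have hn : `|dup_num a d| <= M by rewrite le_max lexx.
have he : `|dup_den a d| <= M by rewrite le_max lexx orbT.
have M0 : 0 <= M by apply: le_trans hn.
have le7 x : `|disc * x ^+ 7| <= (Cf1 * H ^+ 3 * M + Cg1 * H ^+ 3 * M)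
     + (Cf2 * H ^+ 3 * M + Cg2 * H ^+ 3 * M) ->
   `|x| ^+ 7 <= (1 + Cf1 + Cg1 + Cf2 + Cg2) * M * H ^+ 3.
  rewrite normrM normrX => le; apply: (@le_trans _ _ (`|disc| * `|x| ^+ 7)).
    by rewrite ler_peMl ?exprn_ge0 // -gtz0_ge1 normr_gt0.
  apply: le_trans le _.
  have -> : (1 + Cf1 + Cg1 + Cf2 + Cg2) * M * H ^+ 3 =
    (Cf1 * H ^+ 3 * M + Cg1 * H ^+ 3 * M)
     + (Cf2 * H ^+ 3 * M + Cg2 * H ^+ 3 * M) + M * H ^+ 3 by ring.
  by rewrite lerDl mulr_ge0 // exprn_ge0 // ltW.
have H3 : 0 <= H ^+ 3 by rewrite exprn_ge0 // ltW.
have pos C : 0 <= C -> 0 <= C * H ^+ 3 * M by move=> C0; do 2?apply: mulr_ge0.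
have la : `|a| ^+ 7 <= (1 + Cf1 + Cg1 + Cf2 + Cg2) * M * H ^+ 3.
  apply: le7; rewrite -(dup_bezout2 a d).
  apply: (@le_trans _ _ (Cf2 * H ^+ 3 * M + Cg2 * H ^+ 3 * M)).
    by apply: normD_le; apply: normM_le => //; [apply: bf2|apply: bg2].
  by rewrite lerDr addr_ge0 ?pos.
have ld : `|d| ^+ 7 <= (1 + Cf1 + Cg1 + Cf2 + Cg2) * M * H ^+ 3.
  apply: le7; rewrite -(dup_bezout1 a d).
  apply: (@le_trans _ _ (Cf1 * H ^+ 3 * M + Cg1 * H ^+ 3 * M)).
    by apply: normB_le; apply: normM_le => //; [apply: bf1|apply: bg1].
  by rewrite lerDl addr_ge0 ?pos.
have H30 : 0 < H ^+ 3 by rewrite exprn_gt0.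
rewrite -(ler_pM2r H30) -exprD.
have [e|e] : H = `|a| \/ H = `|d| by rewrite /H; case: leP; [right|left].
  by rewrite {1}e.
by rewrite {1}e.
Qed.

Lemma dup_upper : exists2 C : int, 0 < C & forall a d : int,
  Num.max `|dup_num a d| `|dup_den a d| <= C * Num.max `|a| `|d| ^+ 4.
Proof.
have [//|C1 C10 h1] := @hform_bound 4
  [:: (1, 4%N); (- 2 * a4, 2%N); (- 8 * a6, 1%N); (a4 ^+ 2, 0%N)].
have [//|C2 C20 h2] := @hform_bound 4 [:: (4, 3%N); (4 * a4, 1%N); (4 * a6, 0%N)].
exists (1 + C1 + C2) => [|a d]; first by lia.
have ha : `|a| <= Num.max `|a| `|d| by rewrite le_max lexx.
have hd : `|d| <= Num.max `|a| `|d| by rewrite le_max lexx orbT.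
move: (Num.max `|a| `|d|) ha hd => H ha hd.
have H4 : 0 <= H ^+ 4 by rewrite exprn_even_ge0.
rewrite ge_max (le_trans (h1 _ _ _ ha hd)) ?(le_trans (h2 _ _ _ ha hd)) //;
  by rewrite ler_wpM2r //; lia.
Qed.

Lemma ecdouble_height (x y : rat) : EQ a4 a6 (Some (x, y)) -> y != 0 ->
  [/\ dup_den (numq x) (denq x) != 0 & naive_height (ecadd a4 (Some (x, y)) (Some (x, y)))
    = qheight ((dup_num (numq x) (denq x))%:~R / (dup_den (numq x) (denq x))%:~R)].
Proof.
move=> hP y0; have dq0 : (denq x)%:~R != 0 :> rat by rewrite intr_eq0 denq_neq0.
have nE : (numq x)%:~R = x * (denq x)%:~R by rewrite -{2}[x]divq_num_den mulfVK.
have denE : (dup_den (numq x) (denq x))%:~R = 4 * y ^+ 2 * (denq x)%:~R ^+ 4 :> rat.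
  rewrite /dup_den /hform /= !(rmorphD, rmorphM, rmorphXn) /= nE hP ?subn0 ?subSS; ring.
have numE : (dup_num (numq x) (denq x))%:~R =
    (x ^+ 4 - 2 * a4%:~R * x ^+ 2 - 8 * a6%:~R * x + a4%:~R ^+ 2)
    * (denq x)%:~R ^+ 4 :> rat.
  rewrite /dup_num /hform /= !(rmorphD, rmorphM, rmorphXn) /= nE ?subn0 ?subSS; ring.
split.
  rewrite -(intr_eq0 rat) denE; by rewrite !mulf_neq0 ?expf_neq0.
rewrite denE numE /= eqxx /= ifF; last first.
  by rewrite -addr_eq0; apply/negbTE; rewrite -mulr2n mulrn_eq0.
rewrite -/(qheight _); congr qheight.
have a6E : a6%:~R = y ^+ 2 - x ^+ 3 - a4%:~R * x by rewrite hP; ring.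
by rewrite a6E; field; rewrite y0 dq0.
Qed.
End Duplication.

(** * Height inequalities on the group *)

Section GroupHeights.
Variables (a4 a6 : int) (ns : nonsingular a4 a6).
Local Notation G := (ecgroup ns).
Implicit Types P Q : G.

Definition gheight P : int := naive_height (ecpt P).

Lemma gheight_ge1 P : 1 <= gheight P.
Proof. by rewrite /gheight; case: (ecpt P) => [[x y]|] //=; apply: qheight_ge1. Qed.

Lemma gheight0 : gheight 0 = 1.
Proof. by []. Qed.

Lemma gheightN P : gheight (- P) = gheight P.
Proof. by rewrite /gheight ecptN; case: (ecpt P) => [[x y]|]. Qed.

Lemma gheight_double_ub :
  exists2 C : int, 0 < C & forall P, gheight (P + P) <= C * gheight P ^+ 4.
Proof.
have [C C0 hC] := dup_upper a4 a6; exists C => // P.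
have C1 : 1 <= C by lia.
have hge z : 1 <= z -> 1 <= C * z ^+ 4.
  by move=> z1; rewrite -[leLHS]mulr1 ler_pM // exprn_ege1.
have := ecptP P; have := gheight_ge1 P; rewrite /gheight ecptD.
case: (ecpt P) => [[x y]|] //; last by rewrite expr1n mulr1.
have [->|y0] := eqVneq y 0.
  by rewrite /= eqxx oppr0 eqxx => /hge.
move=> _ hP; have [d0 ->] := ecdouble_height hP y0.
apply: le_trans (qheight_frac_le _ d0) _; apply: le_trans (hC _ _) _.
by rewrite (gtr0_norm (denq_gt0 x)).
Qed.

(** [dup_lower] concerns the unreduced fraction; reducing it costs at most the factor |D|, by
    [dup_common]. *)
Lemma gheight_double_lb :
  exists2 C : int, 0 < C & forall P, gheight P ^+ 4 <= C * gheight (P + P).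
Proof.
have [C C0 hC] := dup_lower ns.
set D : int := 4 * (4 * a4 ^+ 3 + 27 * a6 ^+ 2).
have D0 : D != 0 := disc_neq0 ns.
have D1 : 1 <= `|D| by rewrite -gtz0_ge1 normr_gt0.
have kD k : (k %| D)%Z -> `|k| <= `|D|.
  by move=> kD; rewrite -!abszE lez_nat dvdn_leq // absz_gt0.
exists (C * `|D|) => [|P]; first by rewrite mulr_gt0 // normr_gt0.
have := ecptP P; rewrite /gheight ecptD.
case: (ecpt P) => [[x y]|] // hP; last by rewrite expr1n mulr1; nia.
have cop : coprimez (numq x) (denq x) by exact: coprime_num_den.
have := hC (numq x) (denq x) (denq_neq0 x); rewrite (gtr0_norm (denq_gt0 x)) => le.
apply: le_trans le _; rewrite -mulrA ler_pM2l //.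
have [y0|y0] := eqVneq y 0.
  have den0 : dup_den a4 a6 (numq x) (denq x) = 0.
    have nE : (numq x)%:~R = x * (denq x)%:~R :> rat.
      by rewrite -{2}[x]divq_num_den mulfVK // intr_eq0 denq_neq0.
    apply: (@intr_inj rat); rewrite /dup_den /hform /=.
    rewrite !(rmorphD, rmorphM, rmorphXn) /= nE ?subn0 ?subSS.
    transitivity (4 * (denq x)%:~R ^+ 4 * (x ^+ 3 + a4%:~R * x + a6%:~R) : rat).
      by ring.
    by rewrite -hP y0 expr0n mulr0.
  (* Here 2 P is at infinity, of height 1. The denominator form vanishes, so the numerator is itself
     a common divisor and divides D. *)
  rewrite y0 /= eqxx oppr0 eqxx /= mulr1 den0 normr0 maxEle.
  by case: ifP => // _; apply: kD; apply: (dup_common cop); rewrite // den0 dvdz0.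
have [d0 ->] := ecdouble_height hP y0.
have [k [k1 k2 _ ->]] := qheight_frac (dup_num a4 a6 (numq x) (denq x)) d0.
rewrite ler_wpM2r //; last by apply: kD; apply: (dup_common cop).
exact: le_trans (qheight_ge1 _).
Qed.

(** The generic case is [naive_height_add_sub]. For P = Q or P = - Q one factor is 1 and the
    duplication bound applies; the constant adds up those of all cases. *)
Lemma gheight_parallelogram_ub :
  exists2 C : int, 0 < C & forall P Q,
    gheight (P + Q) * gheight (P - Q) <= C * (gheight P * gheight Q) ^+ 2.
Proof.
have [C C0 hC] := gheight_double_ub.
set c := coefbound a4 a6.
have c0 : 1 <= c by rewrite /c /coefbound; lia.
have K0 : 0 <= 18 * c ^+ 2 by rewrite mulr_ge0 // sqr_ge0.
exists (1 + C + 18 * c ^+ 2) => [|P Q]; first by lia.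
have split3 (z w : int) : 0 <= w -> z <= w \/ z <= C * w \/ z <= 18 * c ^+ 2 * w ->
    z <= (1 + C + 18 * c ^+ 2) * w.
  move: (18 * c ^+ 2) K0 => K K0 w0 h; have := mulr_ge0 (ltW C0) w0.
  have := mulr_ge0 K0 w0; rewrite !mulrDl mul1r; lia.
apply: split3; first exact: sqr_ge0.
have [->|P0] := eqVneq P 0.
  by left; rewrite add0r sub0r gheightN gheight0 mul1r.
have [->|Q0] := eqVneq Q 0.
  by left; rewrite addr0 subr0 gheight0 mulr1.
have same (T : G) : gheight (T + T) * gheight 0 <= C * (gheight T * gheight T) ^+ 2.
  by rewrite gheight0 mulr1 -expr2 -exprM.
have [e|nPQ] := eqVneq P Q; first by right; left; rewrite e subrr.
have [e|nPNQ] := eqVneq P (- Q).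
  right; left; rewrite -(gheightN Q) e.
  by rewrite addNr mulrC; exact: same.
right; right.
move: P0 Q0 nPQ nPNQ (ecptP P) (ecptP Q).
rewrite /gheight ecptD ecptD ecptN -!(inj_eq (@ecpt_inj _ _ ns)) ecptN ecpt0.
case: (ecpt P) => [[x1 y1]|] //; case: (ecpt Q) => [[x2 y2]|] // _ _ nPQ nPNQ hP hQ.
have n12 : x1 != x2.
  apply/eqP => e12; move: nPQ nPNQ; rewrite e12.
  have /eqP : (y1 - y2) * (y1 + y2) = 0.
    by rewrite -subr_sqr hP hQ e12 subrr.
  by rewrite mulf_eq0 subr_eq0 addr_eq0 => /orP[] /eqP->; rewrite /= eqxx.
exact: naive_height_add_sub.
Qed.
End GroupHeights.

(** * Canonical heights *)

(** Summing twice: the first differences are at most C n, hence the terms at most C n^2. *)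
Lemma second_difference_bound (R : realDomainType) (e : nat -> R) (C : R) :
  0 <= C -> e 0%N = 0 -> e 1%N = 0 ->
  (forall n, `|e n.+2 + e n - 2 * e n.+1| <= C) ->
  forall n, `|e n| <= C * n%:R ^+ 2.
Proof.
move=> C0 e0 e1 he n.
suff [] : `|e n| <= C * n%:R ^+ 2 /\ `|e n.+1 - e n| <= C * n%:R by [].
elim: n => [|n [IH1 IH2]]; first by rewrite e1 e0 subrr normr0 expr0n !mulr0.
split.
  have -> : e n.+1 = e n + (e n.+1 - e n) by ring.
  apply: le_trans (normD_le IH1 IH2) _; rewrite -mulrDr ler_wpM2l //.
  have : 0 <= n%:R :> R by []. rewrite -natr1; nra.
have -> : e n.+2 - e n.+1 = (e n.+2 + e n - 2 * e n.+1) + (e n.+1 - e n) by ring.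
apply: le_trans (normD_le (he n) IH2) _.
by rewrite -natr1 mulrDr mulr1 addrC.
Qed.

Section CanonicalHeight.
Variables (R : realType) (a4 a6 : int) (ns : nonsingular a4 a6).
Local Notation G := (ecgroup ns).
Implicit Types P Q : G.

Definition wheight P : R := weil_height R (ecpt P).
Definition cheight P : R := canonical_height R a4 (ecpt P).

Lemma gheight_gt0R P : 0 < (gheight P)%:~R :> R.
Proof. by rewrite ltr0z (lt_le_trans _ (gheight_ge1 P)). Qed.

Lemma wheightN P : wheight (- P) = wheight P.
Proof. by rewrite /wheight /weil_height -/(gheight _) gheightN. Qed.

Lemma wheight0 : wheight 0 = 0.
Proof. exact: ln1. Qed.

(** The lower bound follows from the upper one applied to P + Q and P - Q, whose sum and difference
    are 2 P and 2 Q, together with [gheight_double_lb]. *)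
Lemma wheight_parallelogram : exists2 C : R, 0 <= C & forall P Q,
  `|wheight (P + Q) + wheight (P - Q) - 2 * (wheight P + wheight Q)| <= C.
Proof.
have [C1 C10 h1] := gheight_parallelogram_ub ns.
have [C2 C20 h2] := gheight_double_lb ns.
have r1 : 0 < C1%:~R :> R by rewrite ltr0z.
have r2 : 0 < C2%:~R :> R by rewrite ltr0z.
have H0 := gheight_gt0R.
have ub P Q : wheight (P + Q) + wheight (P - Q) <=
    ln C1%:~R + 2 * (wheight P + wheight Q).
  rewrite /wheight /weil_height -!/(gheight _).
  rewrite -!lnM ?posrE // mulr_natl -lnXn ?mulr_gt0 //.
  rewrite -lnM ?posrE ?exprn_gt0 ?mulr_gt0 //.
  rewrite ler_ln ?posrE ?mulr_gt0 ?exprn_gt0 ?mulr_gt0 //.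
  by rewrite -!rmorphM -rmorphXn -rmorphM ler_int.
have lb P : 4 * wheight P <= ln C2%:~R + wheight (P + P).
  rewrite /wheight /weil_height -!/(gheight _).
  rewrite mulr_natl -lnXn // -lnM ?posrE //.
  rewrite ler_ln ?posrE ?mulr_gt0 ?exprn_gt0 //.
  by rewrite -rmorphXn -rmorphM ler_int.
have l1 : 0 <= ln (C1%:~R : R) by rewrite ln_ge0 // ler1z; lia.
have l2 : 0 <= ln (C2%:~R : R) by rewrite ln_ge0 // ler1z; lia.
exists (ln C1%:~R + ln C2%:~R) => [|P Q]; first exact: addr_ge0.
have := ub (P + Q) (P - Q); have := ub P Q; have := lb P; have := lb Q.
have -> : P + Q + (P - Q) = P + P by rewrite addrACA subrr addr0.
have -> : P + Q - (P - Q) = Q + Q by rewrite opprB addrC addrA subrK.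
move: l1 l2; rewrite ler_norml; clear.
move: (ln _) (ln _) (wheight _) (wheight _) (wheight _) (wheight _).
move: (wheight _) (wheight _).
move=> *; apply/andP; split; lra.
Qed.

(** By the parallelogram law for (n + 1) P and P, the quantity inside the norm has bounded second
    differences in n. *)
Lemma wheightMn : exists2 C : R, 0 <= C & forall P n,
  `|wheight (P *+ n) - n%:R ^+ 2 * wheight P| <= C * n%:R ^+ 2.
Proof.
have [C C0 hC] := wheight_parallelogram; exists C => // P.
apply: second_difference_bound => // [||n].
- by rewrite mulr0n wheight0 expr0n mul0r subrr.
- by rewrite mulr1n expr1n mul1r subrr.
have := hC (P *+ n.+1) P; rewrite -mulrSr [P *+ n.+1]mulrSr addrK -mulrSr.
apply: le_trans; rewrite le_eqVlt; apply/orP; left; apply/eqP; congr (`|_|).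
by rewrite -!natr1; ring.
Qed.

Definition hseq P (n : nat) : R := wheight (P *+ n) / n%:R ^+ 2.

Lemma hseqE P : hseq P = (fun n => weil_height R (ecmuln a4 n (ecpt P)) / n%:R ^+ 2).
Proof. by apply/funext => n; rewrite /hseq /wheight ecptMn. Qed.

(** Both terms are compared with the term of index m n, using [wheightMn] for the points m P and n
    P. *)
Lemma hseq_dist : exists2 C : R, 0 <= C & forall P n m, (0 < m <= n)%N ->
  `|hseq P n - hseq P m| <= C / m%:R ^+ 2.
Proof.
have [C C0 hC] := wheightMn; exists (2 * C) => [|P n m /andP[m0 mn]].
  exact: mulr_ge0.
have n0 : (0 < n)%N by apply: leq_trans mn.
have scale k l : (0 < k)%N -> (0 < l)%N ->
    `|hseq P (l * k) - hseq P l| <= C / l%:R ^+ 2.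
  move=> k0 l0; have kR : k%:R != 0 :> R by rewrite pnatr_eq0 -lt0n.
  have lR : l%:R != 0 :> R by rewrite pnatr_eq0 -lt0n.
  have := hC (P *+ l) k; rewrite -mulrnA => h.
  have -> : hseq P (l * k) - hseq P l =
      (wheight (P *+ (l * k)) - k%:R ^+ 2 * wheight (P *+ l)) / (l * k)%:R ^+ 2.
    by rewrite /hseq natrM; field; rewrite kR lR.
  rewrite normrM normfV (ger0_norm (sqr_ge0 _)).
  have -> : C / l%:R ^+ 2 = C * k%:R ^+ 2 / (l * k)%:R ^+ 2.
    by rewrite natrM; field; rewrite kR lR.
  by rewrite ler_wpM2r // invr_ge0 sqr_ge0.
have h1 := scale _ _ m0 n0; have h2 := scale _ _ n0 m0.
have le : C / n%:R ^+ 2 <= C / m%:R ^+ 2.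
  rewrite ler_wpM2l // lef_pV2 ?posrE ?exprn_gt0 ?ltr0n //.
  by rewrite lerXn2r ?nnegrE ?ler_nat.
have -> : 2 * C / m%:R ^+ 2 = C / m%:R ^+ 2 + C / m%:R ^+ 2 by ring.
have -> : hseq P n - hseq P m = (hseq P (m * n) - hseq P m) - (hseq P (n * m) - hseq P n).
  by rewrite (mulnC n m); ring.
by apply: normB_le => //; apply: le_trans le.
Qed.

(** Ensures that the [lim] in [canonical_height] is a genuine limit. *)
Lemma hseq_cvg P : cvg (hseq P @ \oo).
Proof.
have [C C0 hC] := hseq_dist.
apply/cauchy_cvgP/cauchy_exP => eps eps0.
(* This N exceeds C / eps, and N^2 >= N, so C / N^2 < eps. *)
pose N := (Num.bound (C / eps)).+1.
exists (hseq P N); suff: \forall n \near \oo, ball (hseq P N) eps (hseq P n) by [].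
near=> n.
have Nn : (N <= n)%N by near: n; exact: nbhs_infty_ge.
rewrite -ball_normE /= distrC (le_lt_trans (hC _ _ _ _)) //.
have NR : 1 <= N%:R :> R by rewrite ler1n.
rewrite ltr_pdivrMr ?exprn_gt0 ?(lt_le_trans _ NR) // mulrC.
have Ce0 : 0 <= C / eps by rewrite divr_ge0 // ltW.
rewrite -ltr_pdivrMr //; apply: lt_le_trans (archi_boundP Ce0) _.
apply: (@le_trans _ _ N%:R); first by rewrite ler_nat.
by rewrite expr2 ler_peMl // (le_trans _ NR).
Unshelve. all: by end_near.
Qed.

(** Let n tend to infinity in [hseq_dist] and multiply by m^2; the constant is uniform in P and
    m. *)
Lemma cheight_asymp : exists2 C : R, 0 <= C & forall P m,
  `|2^-1 * wheight (P *+ m) - m%:R ^+ 2 * cheight P| <= C.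
Proof.
have [C C0 hC] := hseq_dist; exists (2^-1 * C) => [|P m].
  by rewrite mulr_ge0.
have [->|m0] := posnP m.
  by rewrite mulr0n wheight0 expr0n mul0r mulr0 subrr normr0 mulr_ge0.
have mR : m%:R != 0 :> R by rewrite pnatr_eq0 -lt0n.
have m2 : 0 < m%:R ^+ 2 :> R by rewrite exprn_gt0 // ltr0n.
have cl := @hseq_cvg P.
have lim1 : lim (hseq P @ \oo) <= hseq P m + C / m%:R ^+ 2.
  apply: limr_le => //; near=> n.
  have mn : (0 < m <= n)%N by rewrite m0; near: n; exact: nbhs_infty_ge.
  by have := hC P n m mn; rewrite ler_norml => /andP[]; lra.
have lim2 : hseq P m - C / m%:R ^+ 2 <= lim (hseq P @ \oo).
  apply: limr_ge => //; near=> n.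
  have mn : (0 < m <= n)%N by rewrite m0; near: n; exact: nbhs_infty_ge.
  by have := hC P n m mn; rewrite ler_norml => /andP[]; lra.
rewrite /cheight /canonical_height -hseqE.
move: (lim _) lim1 lim2 => l lim1 lim2.
have -> : 2^-1 * wheight (P *+ m) - m%:R ^+ 2 * (2^-1 * l)
    = 2^-1 * (m%:R ^+ 2 * (hseq P m - l)).
  by rewrite /hseq; field.
rewrite normrM (ger0_norm (_ : 0 <= 2^-1)) // ler_pM2l //.
rewrite normrM (ger0_norm (ltW m2)) mulrC -ler_pdivlMr // ler_norml.
by apply/andP; split; lra.
Unshelve. all: by end_near.
Qed.

Lemma natsq_bounded_eq0 (x C : R) :
  (forall m : nat, `|m%:R ^+ 2 * x| <= C) -> x = 0.
Proof.
move=> h; apply/eqP; rewrite -normr_eq0 eq_le normr_ge0 andbT leNgt.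
apply/negP => x0; have C0 : 0 <= C by apply: le_trans (h 0%N).
pose m := (Num.bound (C / `|x|)).+1.
have := h m; rewrite normrM (ger0_norm (sqr_ge0 _)) -ler_pdivlMr // leNgt => /negP; apply.
have Cx0 : 0 <= C / `|x| by rewrite divr_ge0.
apply: lt_le_trans (archi_boundP Cx0) _.
apply: (@le_trans _ _ m%:R); first by rewrite ler_nat.
by rewrite expr2 ler_peMl // ler1n.
Qed.

(** Multiplied by m^2, both sides approximate half the Weil height of k m P up to a constant uniform
    in m, which forces them to be equal. *)
Lemma cheightMn P k : cheight (P *+ k) = k%:R ^+ 2 * cheight P.
Proof.
have [C C0 hC] := cheight_asymp; apply/eqP; rewrite -subr_eq0; apply/eqP.
apply: (@natsq_bounded_eq0 _ (C + C)) => m.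
have -> : m%:R ^+ 2 * (cheight (P *+ k) - k%:R ^+ 2 * cheight P) =
    (2^-1 * wheight (P *+ (k * m)) - (k * m)%:R ^+ 2 * cheight P)
    - (2^-1 * wheight (P *+ k *+ m) - m%:R ^+ 2 * cheight (P *+ k)).
  by rewrite mulrnA natrM; ring.
exact: normB_le.
Qed.

Lemma cheightN P : cheight (- P) = cheight P.
Proof.
rewrite /cheight /canonical_height -!hseqE; suff -> : hseq (- P) = hseq P by [].
by apply/funext => n; rewrite /hseq mulNrn wheightN.
Qed.

(** Multiplication by r removes the torsion point and scales both heights by r^2. *)
Lemma cheightDtor P Q r : (0 < r)%N -> Q *+ r = 0 -> cheight (P + Q) = cheight P.
Proof.
move=> r0 hQ; have rR : r%:R ^+ 2 != 0 :> R by rewrite expf_neq0 // pnatr_eq0 -lt0n.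
by apply: (mulfI rR); rewrite -!cheightMn mulrnDl hQ addr0.
Qed.

(** Gives the [sup] in [delta] its meaning; this is [cheight_asymp] at m = 1. *)
Lemma has_ubound_delta : has_ubound
  [set 2^-1 * weil_height R P - canonical_height R a4 P | P in EQ a4 a6].
Proof.
have [C C0 hC] := cheight_asymp; exists C => _ [P hP <-].
have := hC (mkpt ns hP) 1%N; rewrite mulr1n expr1n mul1r.
by apply: le_trans; rewrite ler_norm.
Qed.

Lemma wheight_le P : 2^-1 * wheight P <= cheight P + delta R a4 a6.
Proof.
rewrite addrC -lerBlDr; apply: ub_le_sup; first exact: has_ubound_delta.
by exists (ecpt P) => //; exact: ecptP.
Qed.

Lemma delta_ge0 : 0 <= delta R a4 a6.
Proof.
apply: ub_le_sup; first exact: has_ubound_delta.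
exists None => //.
have := cheightMn 0 0; rewrite mulr0n expr0n mul0r /cheight ecpt0 => ->.
by rewrite -/(wheight 0) wheight0 mulr0 subrr.
Qed.

End CanonicalHeight.

(** * Counting points *)

Section Counting.
Variables (a4 a6 : int) (ns : nonsingular a4 a6).
Local Notation G := (ecgroup ns).

(* The pair (A, C^2), which is (1, 0) at infinity. *)
Definition xproj (Q : G) : int * int :=
  if ecpt Q is Some (x, _) then (numq x, denq x) else (1, 0).

(** Separates Q from - Q; the value at infinity is arbitrary, as [xproj] already identifies that
    point. *)
Definition ynonneg (Q : G) : bool := if ecpt Q is Some (_, y) then 0 <= y else false.

Lemma xproj_inj (Q S : G) : xproj Q = xproj S -> ynonneg Q = ynonneg S -> Q = S.
Proof.
move: (ecptP Q) (ecptP S) => hQ hS; rewrite /xproj /ynonneg => hx hy.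
apply: ecpt_inj; move: hQ hS hx hy.
case: (ecpt Q) => [[x y]|]; case: (ecpt S) => [[x' y']|] //.
- move=> hQ hS [nx dx] hy.
  have ex : x = x' by rewrite -[x]divq_num_den nx dx divq_num_den.
  rewrite ex in hQ *; congr (Some (_, _)).
  have /eqP : (y - y') * (y + y') = 0 by rewrite -subr_sqr hQ hS subrr.
  rewrite mulf_eq0 subr_eq0 addr_eq0 => /orP[/eqP//|/eqP ey].
  by move: hy; rewrite ey; case: (ltrgt0P y'); lra.
- by move=> _ _ [_ d0]; have := denq_gt0 x; rewrite d0.
- by move=> _ _ [_ d0]; have := denq_gt0 x'; rewrite -d0.
Qed.

(** The last clause makes A + t C^2 positive once t exceeds twice the height: C^2 >= 1 at affine
    points, and A = 1 at infinity. *)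
Lemma xproj_bound (Q : G) :
  [/\ `|(xproj Q).1| <= gheight Q, 0 <= (xproj Q).2 <= gheight Q
    & 1 <= (xproj Q).1 + gheight Q * (xproj Q).2 * 2].
Proof.
rewrite /xproj /gheight; case: (ecpt Q) => [[x y]|] //=.
have := denq_gt0 x; rewrite -[Num.max _ _]/(qheight x) => d0.
have h1 : `|numq x| <= qheight x by rewrite le_max lexx.
have h2 : denq x <= qheight x by rewrite le_max lexx orbT.
split=> //; first by rewrite ltW.
by move: (qheight_ge1 x) d0 h1; move: (qheight x) (numq x) (denq x); clear; nia.
Qed.

(* The integer a + t d with |a| < t / 2 determines a and d, which in turn
   determine the point up to sign. *)
Lemma count_points (t N : nat) (s : seq G) : uniq s ->
  (forall Q, Q \in s -> 2 * gheight Q < t%:Z) ->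
  (forall Q, Q \in s -> (t%:Z + 1) * gheight Q <= N%:Z) ->
  (size s <= 2 * N)%N.
Proof.
move=> us ht hN.
pose alpha (Q : G) : int := (xproj Q).1 + t%:Z * (xproj Q).2.
pose phi (Q : G) := (alpha Q, ynonneg Q).
pose box := [seq (k%:Z, b) | k <- iota 1 N, b <- [:: true; false]].
have -> : (2 * N)%N = size box by rewrite size_allpairs size_iota mulnC.
rewrite -(size_map phi); apply: uniq_leq_size.
  rewrite map_inj_in_uniq // => Q S Qs Ss [ea ey]; apply: xproj_inj => //.
  have [bQ /andP[_ _] _] := xproj_bound Q; have [bS /andP[_ _] _] := xproj_bound S.
  move: ea bQ bS (ht _ Qs) (ht _ Ss); rewrite /alpha.
  case: (xproj Q) => a d; case: (xproj S) => b e /=.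
  move: (gheight Q) (gheight S) => q r; clear.
  move=> eab ha hb hq hr.
  (* Otherwise t <= t |d - e| = |a - b| <= q + r < t. *)
  have ede : d = e.
    apply/eqP; rewrite eq_le !leNgt; apply/andP; split; apply/negP => lt.
      have : t%:Z * (e + 1) <= t%:Z * d by rewrite ler_wpM2l // lezD1.
      rewrite mulrDr; lia.
    have : t%:Z * (d + 1) <= t%:Z * e by rewrite ler_wpM2l // lezD1.
    by rewrite mulrDr; lia.
  by move: eab; rewrite ede => /addIr ->.
move=> _ /mapP[Q Qs ->]; apply/allpairsP.
exists (`|alpha Q|%N, ynonneg Q) => /=.
have a1 : 1 <= alpha Q.
  have [_ /andP[d0 _] h] := xproj_bound Q; apply: le_trans h _.
  rewrite /alpha lerD2l mulrAC ler_wpM2r // mulrC ltW // ht //.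
have aN : alpha Q <= N%:Z.
  have [h1 /andP[_ h2] _] := xproj_bound Q; apply: le_trans (hN _ Qs).
  rewrite /alpha mulrDl mul1r addrC lerD ?ler_wpM2l //.
  exact: le_trans (ler_norm _) h1.
split.
- by rewrite mem_iota; move: a1 aN; lia.
- by case: (ynonneg Q); rewrite !inE.
- by rewrite gez0_abs // (le_trans _ a1).
Qed.
End Counting.

(** From exp(- ln 2) >= 1 - ln 2 one gets ln 2 >= 1/2, and 16 = 2^4. *)
Lemma ln_ge2 (R : realType) (x : R) : 16 <= x -> 2 <= ln x.
Proof.
move=> hx; have l2 : 2^-1 <= ln (2 : R).
  by have := expR_ge1Dx (- ln (2 : R)); rewrite expRN lnK ?posrE //; lra.
apply: (@le_trans _ _ (ln (16 : R))); last by rewrite ler_ln ?posrE // (lt_le_trans _ hx).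
have -> : 16 = 2 ^+ 4 :> R by ring.
by rewrite lnXn //; lra.
Qed.

(** * Torsion translates of the multiples of a non-torsion point *)

Section MultiplesAndTorsion.
Variables (R : realType) (a4 a6 : int) (ns : nonsingular a4 a6).
Local Notation G := (ecgroup ns).
Variable P : G.
Hypothesis Pntor : ~ Etor a4 a6 (ecpt P).

Lemma nontorsion_Mn n : P *+ n = 0 -> n = 0%N.
Proof.
move=> h; case: n h => // n h; case: Pntor; apply/EtorP.
by exists n.+1.
Qed.

Lemma nontorsion_inj (i j r : nat) : (0 < r)%N -> (P *+ i) *+ r = (P *+ j) *+ r -> i = j.
Proof.
move=> r0; wlog le : i j / (i <= j)%N => [hw|].
  by case/orP: (leq_total i j) => h e; [|apply/esym]; apply: hw.
rewrite -!mulrnA -{1}(subnKC le) mulnDl mulrnDr => /esym /eqP.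
rewrite -subr_eq0 addrAC subrr add0r => /eqP /nontorsion_Mn /eqP.
by rewrite muln_eq0 [r == _]gtn_eqF // orbF subn_eq0 => ge; apply/eqP; rewrite eqn_leq le.
Qed.

Lemma lift_points (s : seq ecpoint) : {in s, forall Q, EQ a4 a6 Q} ->
  exists l : seq G, [seq ecpt Q | Q <- l] = s.
Proof.
elim: s => [|Q s IH] h; first by exists [::].
have [l el] : exists l : seq G, [seq ecpt Q | Q <- l] = s.
  by apply: IH => S Ss; apply: h; rewrite inE Ss orbT.
by exists (mkpt ns (h Q (mem_head _ _)) :: l); rewrite /= el.
Qed.

Lemma torsion_list : exists l : seq G,
  [/\ uniq l, size l = card_tor a4 a6 &
    forall Q, Q \in l -> exists2 r, (0 < r)%N & Q *+ r = 0].
Proof.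
have sub Q : Q \in enum_fset (fset_set (Etor a4 a6)) -> Etor a4 a6 Q.
  (* In the infinite case [fset_set] is empty and the membership is absurd. *)
  have [fin|] := pselect (finite_set (Etor a4 a6)).
    by rewrite -[_ \in _]/(Q \in fset_set _) in_fset_set // inE.
  by rewrite /fset_set; case: pselect.
have [|l el] := @lift_points (enum_fset (fset_set (Etor a4 a6))).
  by move=> Q /sub[].
exists l; split.
- by apply: (@map_uniq _ _ (@ecpt _ _ ns)); rewrite el fset_uniq.
- by rewrite -(size_map (@ecpt _ _ ns)) el.
- move=> Q Ql; apply/EtorP/sub; rewrite -el; exact: map_f.
Qed.

(** The index k stands for the multiple k - M, between - M and M. Multiplying by the product of two
    torsion orders removes the torsion parts, so k is determined first. *)
Lemma translates_uniq (M : nat) (l : seq G) : uniq l ->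
  (forall Q, Q \in l -> exists2 r, (0 < r)%N & Q *+ r = 0) ->
  uniq [seq P *+ k - P *+ M + Q | k <- iota 0 (2 * M).+1, Q <- l].
Proof.
move=> ul tl; apply: allpairs_uniq => //; first exact: iota_uniq.
move=> [? ?] [? ?] /allpairsP[[k Q1] [_ Ql [-> ->]]].
move=> /allpairsP[[k' Q2] [_ Q'l [-> ->]]] /= h; rewrite /= in Ql Q'l.
have e : P *+ k + Q1 = P *+ k' + Q2.
  by apply: (addIr (- (P *+ M))); rewrite addrAC h addrAC.
have [r r0 er] := tl _ Ql; have [r' r'0 er'] := tl _ Q'l.
have ek : k = k'.
  apply: (@nontorsion_inj _ _ (r * r')); first by rewrite muln_gt0 r0.
  have : (P *+ k + Q1) *+ (r * r') = (P *+ k' + Q2) *+ (r * r') by rewrite e.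
  by rewrite !mulrnDl (mulrnA Q1) er mul0rn (mulnC r) (mulrnA Q2) er' mul0rn !addr0.
by move: e; rewrite ek => /addrI ->.
Qed.

Lemma cheight_translate (M k : nat) (Q : G) (r : nat) (B : R) :
  (k <= 2 * M)%N -> (0 < r)%N -> Q *+ r = 0 -> 0 <= cheight R P ->
  M%:R ^+ 2 * cheight R P <= B -> cheight R (P *+ k - P *+ M + Q) <= B.
Proof.
move=> kM r0 er hP; apply: le_trans; rewrite (cheightDtor _ _ r0 er).
have [le|/ltnW le] := leqP M k.
  by rewrite -mulrnBr // cheightMn ler_wpM2r // lerXn2r ?nnegrE // ler_nat; lia.
rewrite -cheightN opprB -mulrnBr // cheightMn ler_wpM2r // lerXn2r ?nnegrE //.
by rewrite ler_nat; lia.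
Qed.
End MultiplesAndTorsion.

(** * The lower bound for the canonical height *)

Theorem corollary1p2 (R : realType) (a4 a6 : int) (hE : nonsingular a4 a6)
    (hrank : (0 < ecrank R a4 a6)%E) (t : nat) (ht : (0 < t)%N)
    (hDlow : 4 * (t%:R + 1) ^+ 2 * expR (4 * delta R a4 a6) <
             (Dt a4 a6 t)%:~R :> R)
    (hDup : (Dt a4 a6 t)%:~R < (t%:R + 1) ^+ 2 * t%:R ^+ 2 :> R)
    (P : ecpoint) (hP : EQ a4 a6 P) (hPtor : ~ Etor a4 a6 P) :
  let D : R := (Dt a4 a6 t)%:~R in
  let tor : R := (card_tor a4 a6)%:R in
  canonical_height R a4 P >
    pi ^+ 2 * tor ^+ 2 / (Num.sqrt D * (ln D + 2) + pi * tor) ^+ 2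
    * TE R a4 a6 (Dt a4 a6 t) t.
Proof.
rewrite /TE; cbv zeta; set tor : R := (card_tor a4 a6)%:R.
set D : R := (Dt a4 a6 t)%:~R in hDlow hDup *.
have d0 := delta_ge0 R hE.
have t1 : 1 <= t%:R :> R by rewrite ler1n.
set u : R := 4 * (t%:R + 1) ^+ 2 in hDlow *.
have u16 : 16 <= u by rewrite /u; nra.
have u0 : 0 < u by lra.
have Du : u < D.
  apply: le_lt_trans hDlow; rewrite ler_peMr ?(ltW u0) //.
  by apply: (le_trans _ (expR_ge1Dx _)); lra.
have D0 : 0 < D by lra.
set T := ln (D / u) - _.
(* This is the assumed lower bound for D(t). *)
have T0 : 0 < T.
  rewrite subr_gt0 -ltr_expR lnK ?posrE ?divr_gt0 //.
  by rewrite ltr_pdivlMr // mulrC.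
set q := Num.sqrt D.
have q2 : q ^+ 2 = D by rewrite sqr_sqrtr // ltW.
have q0 : 0 < q by rewrite sqrtr_gt0.
pose N := Num.truncn (q / 2).
(* This count serves twice: for the positivity of the height of P and for the torsion translates. *)
have count (s : seq (ecgroup hE)) : uniq s ->
    (forall Q, Q \in s -> cheight R Q <= T / 4) -> (size s)%:R <= q.
  move=> us hs.
  have key Q : Q \in s -> 2 * (t%:R + 1) * (gheight Q)%:~R <= q.
    move=> Qs; have g0 := gheight_gt0R R Q.
    have := wheight_le R Q; have := hs _ Qs.
    rewrite /wheight /weil_height -/(gheight Q) => h1 h2.
    (* Here 2 log H <= T + 4 delta, which is log (D / u) because T contains - 4 delta. *)
    have h3 : ln ((gheight Q)%:~R ^+ 2) <= ln (D / u).
      by rewrite lnXn // -mulr_natl; rewrite /T in h1; lra.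
    rewrite ler_ln ?posrE ?exprn_gt0 ?divr_gt0 // ler_pdivlMr // in h3.
    rewrite -(@ler_pXn2r _ 2) ?nnegrE ?q2 ?(ltW q0) //; last first.
      by rewrite !mulr_ge0 ?ltW //; lra.
    by apply: le_trans h3; rewrite /u le_eqVlt; apply/orP; left; apply/eqP; ring.
  (* The assumed upper bound for D(t); with [key] it gives 2 H < t. *)
  have qt : q < (t%:R + 1) * t%:R.
    have qt0 : 0 <= (t%:R + 1) * t%:R :> R by rewrite mulr_ge0 ?addr_ge0.
    by rewrite -(@ltr_pXn2r _ 2) ?nnegrE ?(ltW q0) // q2 exprMn.
  apply: (@le_trans _ _ (2 * N)%:R); last first.
    rewrite natrM; have : N%:R <= q / 2 by rewrite truncn_le ?divr_ge0 // ltW.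
    by lra.
  rewrite ler_nat; apply: (count_points (t := t) us) => Q Qs; have h := key _ Qs.
    rewrite -(ltr_int R) rmorphM /=.
    have : (t%:R + 1) * (2 * (gheight Q)%:~R) < (t%:R + 1) * t%:R :> R.
      by apply: le_lt_trans qt; apply: le_trans h; rewrite mulrA [_ * 2]mulrC.
    by rewrite ltr_pM2l //; lra.
  have g0 : 0 <= (t%:Z + 1) * gheight Q.
    by rewrite mulr_ge0 // (le_trans _ (gheight_ge1 Q)).
  rewrite -(gez0_abs g0) lez_nat truncn_ge_nat ?divr_ge0 ?(ltW q0) //.
  have -> : (`|((t%:Z + 1) * gheight Q)%R|%N)%:R = (t%:R + 1) * (gheight Q)%:~R :> R.
    by rewrite natr_absz ger0_norm // rmorphM rmorphD.
  by rewrite ler_pdivlMr //; lra.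
pose P0 := mkpt hE hP.
have eP : canonical_height R a4 P = cheight R P0 by [].
have ntor : ~ Etor a4 a6 (ecpt P0) by [].
rewrite eP; move: P0 ntor {eP} => {hPtor} P0 ntor; clear P hP; rename P0 into P.
(* Otherwise all multiples of P have height at most 0, and floor(q) + 1 of them contradict
   [count]. *)
have c0 : 0 < cheight R P.
  rewrite ltNge; apply/negP => le0.
  have : (size [seq P *+ i | i <- iota 0 (Num.truncn q).+1])%:R <= q.
    apply: count => [|Q /mapP[i _ ->]].
      rewrite map_inj_uniq ?iota_uniq // => i j e.
      by apply: (nontorsion_inj ntor (r := 1)); rewrite // e.
    rewrite cheightMn; apply: (@le_trans _ _ 0); last by rewrite ltW // divr_gt0.
    by rewrite mulr_ge0_le0.
  by rewrite size_map size_iota leNgt truncnS_gt.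
set c := cheight R P in c0 *.
(* If [card_tor] is 0, the claim reduces to 0 < c. *)
have [tor0|torn0] := posnP (card_tor a4 a6).
  by rewrite /tor tor0 expr0n mulr0 !mul0r.
have tor1 : 1 <= tor by rewrite ler1n.
set S := Num.sqrt (T / c).
have S2 : S ^+ 2 = T / c by rewrite sqr_sqrtr // divr_ge0 // ltW.
have S0 : 0 <= S by apply: sqrtr_ge0.
(* The largest M with M^2 c <= T / 4. *)
pose M := Num.truncn (S / 2).
have M1 : M%:R <= S / 2 by rewrite truncn_le ?divr_ge0.
have M2 : S / 2 < M%:R + 1 by rewrite natr1 truncnS_gt.
have [l [ul sl tl]] := torsion_list hE.
have hq : tor * (2 * M%:R + 1) <= q.
  have -> : tor * (2 * M%:R + 1) = ((2 * M).+1 * size l)%N%:R.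
    by rewrite natrM -[in RHS]natr1 natrM sl mulrC.
  rewrite -{1}(size_iota 0 (2 * M).+1).
  rewrite -(size_allpairs (fun k Q => P *+ k - P *+ M + Q)).
  apply: count; first exact: translates_uniq.
  move=> _ /allpairsP[[k Q] [kM Ql ->]]; have [r r0 er] := tl Q Ql.
  have {}kM : (k <= 2 * M)%N by move: kM; rewrite mem_iota.
  apply: (cheight_translate _ r0 er) => //; first exact: ltW.
  rewrite -ler_pdivlMr // mulrAC -S2.
  by have : 0 <= M%:R :> R by []; nra.
(* With pi < 4 this gives pi <= log D + 2, which links the count to the stated denominator. *)
have lnD : 2 <= ln D by apply: ln_ge2; lra.
have pi4 : pi < 4 :> R by have := pihalf_lt2 R; lra.
have pi0 := pi_gt0 R.
set K := q * (ln D + 2) + pi * tor.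
(* Since S < 2 M + 2, [hq] yields tor (S - 1) < q, which is then multiplied by pi. *)
have KS : pi * tor * S < K.
  have h1 : tor * (S - 1) < q.
    by apply: lt_le_trans hq; rewrite ltr_pM2l; lra.
  have h2 : pi * (tor * (S - 1)) < pi * q by rewrite ltr_pM2l.
  have h3 : pi * q <= q * (ln D + 2) by rewrite mulrC ler_pM2l //; lra.
  by rewrite /K; lra.
have K0 : 0 < K by apply: le_lt_trans KS; rewrite !mulr_ge0 //; lra.
(* The claim becomes (pi tor S)^2 < K^2. *)
have -> : T = S ^+ 2 * c by rewrite S2 mulfVK // gt_eqF.
rewrite mulrA gtr_pMl // mulrAC.
rewrite ltr_pdivrMr ?exprn_gt0 // mul1r -!exprMn ltr_pXn2r ?nnegrE //; last exact: ltW.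
by rewrite !mulr_ge0 //; lra.
Qed.
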